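(* Let $m,n\ge1$ be integers and let $K_{m,n}$ be the complete bipartite graph with vertices $v_1,\dots,v_m$ and $w_1,\dots,w_n$, having one edge joining $v_i$ to $w_j$ for each $1\le i\le m$, $1\le j\le n$. Then $$\mathrm{NTC}(\{K_{m,n}\})=\Big\lceil\frac{mn}{2}\Big\rceil\,\pi.$$
   Context: Mappings $f$ of a finite graph $\Gamma$ into $\mathbb{R}^N$ are piecewise $C^2$: after adding finitely many degree-2 vertices, each edge is mapped as a regular $C^2$ arc up to its endpoints; $f$ need not be an embedding. Net total curvature: at a vertex $q$ of degree $d$ with unit tangent vectors $T_1,\dots,T_d\in S^{N-1}$ pointing into the edges ending at $q$, let $\chi_i:S^{N-1}\to\{\pm1\}$ be $-1$ where $\langle e,T_i\rangle>0$ and $+1$ where $\langle e,T_i\rangle<0$ (a.e.). Set $\mathrm{ntc}(q)=\pi$ times the average over $e\in S^{N-1}$ of $\big[\sum_{i=1}^d\chi_i(e)\big]^+$ (for $N=1$, the average over $S^0=\{\pm1\}$), and $\mathrm{NTC}(f)=\sum_q\mathrm{ntc}(q)+\int|\vec k|\,ds$, the sum over all vertices (including those of degree 2) and the integral of the curvature over the open $C^2$ edges. $\mathrm{NTC}(\{\Gamma\})$ is the infimum of $\mathrm{NTC}(f)$ over all mappings $f:\Gamma\to\mathbb{R}^N$ (all $N$). *)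

(* Defs.v *)
From HB Require Import structures.
From mathcomp Require Import all_boot all_order all_algebra.
From mathcomp Require Import all_classical all_reals all_analysis.
Set Implicit Arguments.
Unset Strict Implicit.
Unset Printing Implicit Defensive.
Import Order.TTheory GRing.Theory Num.Theory.
Import numFieldNormedType.Exports.
Local Open Scope classical_set_scope.
Local Open Scope ring_scope.

(* Multigraphs; loops and multiple edges are allowed, and the direction of an
   edge only serves to parametrize it from its source to its target. *)
Record graph := Graph {
  vertex : finType;
  edge : finType;
  src : edge -> vertex;
  tgt : edge -> vertex }.

Definition Kmn (m n : nat) : graph :=
  @Graph ('I_m + 'I_n)%type ('I_m * 'I_n)%type
    (fun e => inl e.1) (fun e => inr e.2).

(* The subdivision of G in which edge e receives k e new vertices of degree 2:
   the new vertices on e are (e, 0), ..., (e, k e - 1) in order from src e to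
   tgt e, and the new edge (e, i) ends at the new vertex (e, i) (or at tgt e
   if i = k e) and starts at the new vertex (e, i - 1) (or at src e
   if i = 0). *)
Section Subdivision.
Variables (G : graph) (k : edge G -> nat).

Definition sub_vertex : finType := (vertex G + {e : edge G & 'I_(k e)})%type.
Definition sub_edge : finType := {e : edge G & 'I_(k e).+1}.

Definition sub_src (p : sub_edge) : sub_vertex :=
  let: existT e i := p in
  if unlift ord0 i is Some j then inr (Tagged (fun e => 'I_(k e)) j)
  else inl (src e).

Definition sub_tgt (p : sub_edge) : sub_vertex :=
  let: existT e i := p in
  if unlift ord_max i is Some j then inr (Tagged (fun e => 'I_(k e)) j)
  else inl (tgt e).

Definition subdivision : graph := Graph sub_src sub_tgt.

End Subdivision.

Section Euclidean.
Variables (R : realType) (N : nat).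

Definition dotp (u v : 'rV[R]_N) : R := \sum_(i < N) u 0 i * v 0 i.

(* The library norm on 'rV[R]_N is the sup norm, hence this definition. *)
Definition enorm (u : 'rV[R]_N) : R := Num.sqrt (dotp u u).

Definition normalize (u : 'rV[R]_N) : 'rV[R]_N := (enorm u)^-1 *: u.

End Euclidean.

(* Integration against N-dimensional Lebesgue measure, as an iterated integral
   (Tonelli); it is only applied to nonnegative Borel functions. *)
Fixpoint lebesgue_int (R : realType) (N : nat) :
    ('rV[R]_N -> \bar R) -> \bar R :=
  match N with
  | 0 => fun g => g 0
  | N'.+1 => fun g =>
      (\int[@lebesgue_measure R]_x
        lebesgue_int (fun v : 'rV[R]_N' => g (row_mx (x%:M : 'M[R]_1) v)))%E
  end.

(* The average of h over the unit sphere of R^N (N >= 1), for h bounded,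
   nonnegative and Borel.  The uniform probability measure of the sphere is
   the cone measure: A has mass vol {t u | u in A, 0 < t <= 1} / vol (unit
   ball), so one averages h (x / |x|) over the unit ball.  For N = 1 this is
   (h 1 + h (-1)) / 2. *)
Definition sphere_mean (R : realType) (N : nat) (h : 'rV[R]_N -> R) : R :=
  let B := [set x : 'rV[R]_N | enorm x <= 1] in
  fine (lebesgue_int (fun x => (\1_B x * h (normalize x))%:E))
  / fine (lebesgue_int (fun x => (\1_B x)%:E)).

Section Arcs.
Variables (R : realType) (N : nat).

(* A regular arc of class C^2 up to its endpoints, parametrized by [0, 1].
   Being C^2 on [0, 1] with one-sided derivatives at 0 and 1 amounts to being
   the restriction of a C^2 function on R; the values outside [0, 1] are
   immaterial. *)
Definition regular_C2 (g : R -> 'rV[R]_N) : Prop :=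
  [/\ forall t, derivable g t 1,
      forall t, derivable (derive1 g) t 1,
      continuous (derive1 (derive1 g)) &
      forall t, 0 <= t <= 1 -> derive1 g t != 0].

Definition unit_tangent (g : R -> 'rV[R]_N) (t : R) : 'rV[R]_N :=
  normalize (derive1 g t).

(* The curvature vector is dT/ds, with ds = |g'(t)| dt. *)
Definition curvature (g : R -> 'rV[R]_N) (t : R) : 'rV[R]_N :=
  (enorm (derive1 g t))^-1 *: derive1 (unit_tangent g) t.

Definition total_curvature (g : R -> 'rV[R]_N) : \bar R :=
  (\int[@lebesgue_measure R]_(t in `]0%R, 1%R[)
     (enorm (curvature g t) * enorm (derive1 g t))%:E)%E.

End Arcs.

(* A map of G to R^N under which every edge is a regular C^2 arc. *)
Record C2_map (R : realType) (G : graph) (N : nat) := C2Map {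
  vpos : vertex G -> 'rV[R]_N;
  arc : edge G -> R -> 'rV[R]_N;
  arc_regular : forall e, regular_C2 (arc e);
  arc_src : forall e, arc e 0 = vpos (src e);
  arc_tgt : forall e, arc e 1 = vpos (tgt e) }.

Section NTC.
Variables (R : realType) (G : graph) (N : nat) (f : C2_map R G N).

(* chi for the unit tangent vector T.  The value on the null set <e, T> = 0
   is irrelevant; it is 0 here. *)
Definition chi (T e : 'rV[R]_N) : R := - Num.sg (dotp e T).

(* The edge-ends at q are the starts of the edges with source q and the ends
   of the edges with target q; a loop at q contributes both. *)
Definition chi_sum (q : vertex G) (e : 'rV[R]_N) : R :=
  \sum_(a : edge G | src a == q) chi (unit_tangent (arc f a) 0) e
  + \sum_(a : edge G | tgt a == q) chi (- unit_tangent (arc f a) 1) e.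

Definition ntc (q : vertex G) : R :=
  pi * sphere_mean (fun e => Num.max (chi_sum q e) 0).

Definition NTC : \bar R :=
  ((\sum_(q : vertex G) ntc q)%:E
   + \sum_(a : edge G) total_curvature (arc f a))%E.

End NTC.

(* A piecewise C^2 map of G to R^N is a C2_map of some subdivision of G. *)
Definition NTC_inf (R : realType) (G : graph) : \bar R :=
  ereal_inf [set x | exists N (k : edge G -> nat)
    (f : C2_map R (subdivision k) N), (0 < N)%N /\ x = NTC f].

(* Main.v *)
From HB Require Import structures.
From mathcomp Require Import all_boot all_order all_algebra.
From mathcomp Require Import all_classical all_reals all_analysis.
From mathcomp Require Import measurable_realfun ring lra zify.
Require Import Defs.
Set Implicit Arguments.
Unset Strict Implicit.
Unset Printing Implicit Defensive.
Import Order.TTheory GRing.Theory Num.Theory.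
Import numFieldNormedType.Exports.
Local Open Scope classical_set_scope.
Local Open Scope ring_scope.

(** Let f be a piecewise C2 map, let x be a direction, and consider the height
[dotp x f].  At a vertex q, for almost every x, [chi_sum f q x] is the number of
edge-ends that go down from q minus the number of those that go up, and ntc(q) is pi
times the mean over x of its positive part.  By the Crofton formula on the sphere,
the total curvature of an arc is pi times the mean number of critical points of the
height inside the arc, that is, pi times the mean of twice the number of its local
maxima.  So NTC(f) is pi times the mean over x of the number of local maxima of
the height, those inside the arcs counting 2 and those at the vertices counting
with their excess.

For a fixed x and a set S of vertices lying above all the others, the excesses of
the vertices of S and the interior maxima add up to at least the number of edges
with exactly one end in S ([crossing_le_max]), because an edge with both ends in S
never contributes negatively and an edge that enters S from below contributes 1.
In the complete bipartite graph, S can be chosen so that its complement contains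
half of one of the two classes of vertices and at most half of the other
([median_cut]); then at least half of the m n edges cross ([bipartite_crossing]).
The number of crossing edges is an integer, so it is at least the ceiling of
m n / 2, and [NTC_ge] integrates this bound.

The bound is attained by a map to the line with straight edges: half of the v_i at
the top, half at the bottom, the w_j in between, and the remaining v_i, if m is
odd, in the middle of the w_j ([Kmn_pos], [NTC_Kmn_le]).

The analytic part of the proof is the Crofton inequality [crofton].  The mean over
the sphere is defined by an iterated integral over the unit ball; it is the integral
for a probability measure [direction_law], invariant under orthogonal maps
([vol_orth], by the uniqueness argument for Haar measure, which needs only
invariance under translations and Tonelli's theorem).  Invariance under the
reflections in lines makes the probability of separation superadditive along half
a great circle ([prob_sep_le]), and this bounds it for close unit vectors by their
distance over pi, up to a factor tending to 1 ([prob_sep_bound]).  Sampling the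
tangent of an arc at dyadic times gives the inequality, because the sum of
the chords of the tangent indicatrix is at most its length, which is the total
curvature ([curvature_primitive]). *)

(** * Lebesgue measure on row vectors *)

Section RowMeasurable.
Variables (R : realType) (n : nat).

(** The sigma-algebra put on row vectors is the one generated by the coordinates:
    it makes a map into row vectors measurable as soon as its coordinates are. *)
Definition coord (i : 'I_n) (x : 'rV[R]_n) : R := x 0 i.

Let rv_set0 : g_sigma_preimage coord set0.
Proof. exact: sigma_algebra0. Qed.

Let rv_setC A : g_sigma_preimage coord A -> g_sigma_preimage coord (~` A).
Proof. exact: sigma_algebraC. Qed.

Let rv_bigcup (F : _^nat) : (forall i, g_sigma_preimage coord (F i)) ->
  g_sigma_preimage coord (\bigcup_i (F i)).
Proof. exact: sigma_algebra_bigcup. Qed.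

HB.instance Definition _ := @isMeasurable.Build default_measure_display
  'rV[R]_n (g_sigma_preimage coord) rv_set0 rv_setC rv_bigcup.

Lemma measurable_coord (i : 'I_n) :
  measurable_fun [set: 'rV[R]_n] (fun x : 'rV[R]_n => x 0 i).
Proof.
move=> _ Y mY; rewrite setTI; apply: sub_sigma_algebra => /=.
rewrite -bigcup_seq/=; exists i => /=; first by rewrite mem_index_enum.
by exists Y => //; rewrite setTI.
Qed.

Lemma measurable_fun_row d (T : measurableType d) (f : T -> 'rV[R]_n) :
  (forall i, measurable_fun [set: T] (fun x => f x 0 i)) ->
  measurable_fun [set: T] f.
Proof.
move=> mf.
have H : g_sigma_preimage (fun i => coord i \o f) `<=` measurable.
  apply: smallest_sub; first exact: sigma_algebra_measurable.
  rewrite -bigcup_seq/=; apply: bigcup_sub => i _.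
  by move=> A [B mB <-]; exact: mf.
move: H; rewrite g_sigma_preimage_comp => prefS.
by move=> _ A mA; apply: prefS; exists A.
Qed.

End RowMeasurable.

Section Volume.
Variable R : realType.
Notation leb := (@lebesgue_measure R).

Definition cons_row n (p : R * 'rV[R]_n) : 'rV[R]_n.+1 :=
  row_mx (p.1%:M : 'M[R]_1) p.2.
Definition uncons_row n (x : 'rV[R]_n.+1) : R * 'rV[R]_n :=
  (x 0 ord0, @rsubmx R 1 1 n x).

Lemma cons_row0 n (p : R * 'rV[R]_n) : cons_row p 0 ord0 = p.1.
Proof.
have -> : ord0 = lshift n (ord0 : 'I_1) :> 'I_(1 + n) by apply: val_inj.
transitivity ((p.1%:M : 'M[R]_1) 0 0); first exact: row_mxEl.
by rewrite mxE eqxx.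
Qed.

Lemma cons_rowS n (p : R * 'rV[R]_n) (i : 'I_n) : cons_row p 0 (lift ord0 i) = p.2 0 i.
Proof.
have -> : lift ord0 i = rshift 1 i :> 'I_(1 + n) by apply: val_inj.
exact: row_mxEr.
Qed.

Lemma cons_rowK n : cancel (@cons_row n) (@uncons_row n).
Proof.
move=> [x v]; rewrite /uncons_row cons_row0/=; congr pair.
exact: (@row_mxKr R 1 1 n).
Qed.

Lemma measurable_cons_row n :
  measurable_fun [set: measurableTypeR R * 'rV[R]_n] (@cons_row n).
Proof.
apply: measurable_fun_row => i; case: (unliftP ord0 i) => [j ->|->].
  under eq_fun do rewrite cons_rowS.
  apply: (@measurableT_comp _ _ _ _ _ _ (fun v : 'rV[R]_n => v 0 j)) => //.
  exact: measurable_coord.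
under eq_fun do rewrite cons_row0.
exact: measurable_fst.
Qed.

Lemma measurable_uncons_row n : measurable_fun [set: 'rV[R]_n.+1]
  (@uncons_row n : _ -> measurableTypeR R * 'rV[R]_n).
Proof.
apply: measurable_fun_pair; first exact: measurable_coord.
apply: measurable_fun_row => i.
have -> : (fun x : 'rV[R]_n.+1 => (uncons_row x).2 0 i) =
          (fun x => x 0 (rshift 1 i : 'I_n.+1)).
  by apply/funext => x; rewrite mxE.
exact: measurable_coord.
Qed.
Local Open Scope ereal_scope.

Section Step.
Variables (n : nat) (mu : {sigma_finite_measure set 'rV[R]_n -> \bar R}).
Definition step_volume : set 'rV[R]_n.+1 -> \bar R :=
  pushforward (leb \x mu) (@cons_row n).

Let step_volume0 : step_volume set0 = 0.
Proof. by rewrite /step_volume /pushforward preimage_set0 measure0. Qed.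

Let preim A : measurable A -> measurable (@cons_row n @^-1` A).
Proof. by move=> mA; rewrite -[X in measurable X]setTI; exact: measurable_cons_row. Qed.

Let step_volume_ge0 A : 0 <= step_volume A.
Proof. exact: (measure_ge0 (leb \x mu)). Qed.

Let step_volume_additive : semi_sigma_additive step_volume.
Proof.
move=> F mF tF mUF; rewrite /step_volume /pushforward preimage_bigcup.
apply: (@measure_semi_sigma_additive _ _ _ (leb \x mu)
  (fun k => @cons_row n @^-1` F k)).
- by move=> k; exact: preim.
- apply/trivIsetP => /= i j _ _ ij; rewrite -preimage_setI.
  by move/trivIsetP : tF => /(_ _ _ _ _ ij) ->//; rewrite preimage_set0.
- by rewrite -preimage_bigcup; exact: preim.
Qed.

HB.instance Definition _ := isMeasure.Build _ _ _
  step_volume step_volume0 step_volume_ge0 step_volume_additive.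

Let step_volume_sigma_finite : sigma_finite setT step_volume.
Proof.
have /sigma_finiteP[F [TF ndF Foo]] := sigma_finiteT leb.
have /sigma_finiteP[G [TG ndG Goo]] := sigma_finiteT mu.
exists (fun k => @uncons_row n @^-1` (F k `*` G k)).
  rewrite -preimage_bigcup -[LHS](preimage_setT (@uncons_row n)); congr preimage.
  rewrite -setXTT TF TG predeqE => -[x y]; split.
    move=> [/= [i _ Fnx] [k _ Gky]]; exists (maxn i k) => //; split.
    - by move: x Fnx; exact/subsetPset/ndF/leq_maxl.
    - by move: y Gky; exact/subsetPset/ndG/leq_maxr.
  by move=> [i _ []/= ? ?]; split; exists i.
move=> k; have [mFk Fkoo] := Foo k; have [mGk Gkoo] := Goo k; split.
  rewrite -[X in measurable X]setTI; apply: measurable_uncons_row => //.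
  exact: measurableX.
rewrite /step_volume /pushforward (_ : _ @^-1` _ = F k `*` G k); last first.
  by apply/seteqP; split => p; rewrite /preimage /mkset cons_rowK.
by rewrite product_measure1E// lte_mul_pinfty// ge0_fin_numE.
Qed.

HB.instance Definition _ := Measure_isSigmaFinite.Build _ _ _
  step_volume step_volume_sigma_finite.

End Step.

(** The measure in dimension n + 1 is the image of the product of the measure of
    the line with the measure in dimension n; Tonelli's theorem is then the
    recursive step of the iterated integral. *)
Lemma volume_exists n : exists mu : {sigma_finite_measure set 'rV[R]_n -> \bar R},
  forall g, measurable_fun [set: 'rV[R]_n] (g : _ -> \bar R) -> (forall x, 0 <= g x) ->
  lebesgue_int g = \int[mu]_x g x.
Proof.
elim: n => [|n [mu muE]].
  exists (\d_(0%R : 'rV[R]_0)) => g mg g0 /=.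
  by rewrite integral_dirac// diracT mul1e.

exists (step_volume mu) => g mg g0 /=.
transitivity (\int[pushforward (leb \x mu) (@cons_row n)]_y g y); last by [].
have mj := @measurable_cons_row n.
have H := @ge0_integral_pushforward _ _ _ _ R _ mj (leb \x mu)%E setT g measurableT mg.
rewrite H; last by move=> y _; exact: g0.
rewrite preimage_setT.
have -> := @fubini_tonelli1 _ _ _ _ R leb mu (g \o @cons_row n)
  (measurableT_comp mg mj) (fun x => g0 _).
apply: eq_integral => x _; rewrite muE//.
exact: (measurableT_comp mg (measurableT_comp mj (measurable_pair1 x))).
Qed.

(** The measure behind the iterated integral.  Having it turns statements about
    the recursion on the dimension into statements about integrals, to which
    Tonelli's theorem applies. *)
Definition vol n := proj1_sig (cid (volume_exists n)).

Lemma lebesgue_intE n (g : 'rV[R]_n -> \bar R) :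
  measurable_fun [set: 'rV[R]_n] g -> (forall x, 0 <= g x) ->
  lebesgue_int g = \int[vol n]_x g x.
Proof. exact: (proj2_sig (cid (volume_exists n))). Qed.

Lemma measurable_addr n (a : 'rV[R]_n) :
  measurable_fun [set: 'rV[R]_n] (fun x : 'rV[R]_n => (x + a)%R).
Proof.
apply: measurable_fun_row => i; under eq_fun do rewrite mxE.
by apply: measurable_funD => //; exact: measurable_coord.
Qed.

(** Translates of half-open intervals have the same length, and these intervals
    determine the measure. *)
Lemma lebesgue_shift (a : R) (g : R -> \bar R) : measurable_fun setT g ->
  (forall x, 0 <= g x) ->
  \int[leb]_x g (x + a)%R = \int[leb]_x g x.
Proof.
move=> mg g0.
have ms : measurable_fun [set: measurableTypeR R]
    ((fun x => x + a)%R : _ -> measurableTypeR R).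
  exact: measurable_funD.
have H := @ge0_integral_pushforward _ _ _ _ R _ ms leb setT g measurableT mg.
rewrite preimage_setT in H.
rewrite -[LHS]H; last by move=> y _; exact: g0.
apply: eq_measure_integral => A mA _.
apply/esym; apply: lebesgue_measure_unique => //= _ [[b c]] _ <-.
rewrite /pushforward.
have -> : ((fun x => x + a) @^-1` `]b, c])%R = `](b - a)%R, (c - a)%R]%classic.
  by apply/seteqP; split => x /=; rewrite !in_itv/= ltrBlDr lerBrDr.
rewrite !lebesgue_measure_itv/= !lte_fin ltrD2r -!EFinB.
by rewrite (_ : c - a - (b - a) = c - b)%R//; ring.
Qed.

Lemma cons_row_add n (p : R * 'rV[R]_n) (a : 'rV[R]_n.+1) :
  (cons_row p + a = cons_row (p.1 + (uncons_row a).1, p.2 + (uncons_row a).2))%R.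
Proof.
apply/rowP => i; rewrite mxE; case: (unliftP ord0 i) => [j ->|->].
  rewrite !cons_rowS/= 2!mxE; congr (_ + a 0 _)%R; exact: val_inj.
by rewrite !cons_row0.
Qed.

Lemma measurable_slice n (g : 'rV[R]_n.+1 -> \bar R) (x : R) :
  measurable_fun [set: 'rV[R]_n.+1] g ->
  measurable_fun [set: 'rV[R]_n] (fun v => g (cons_row (x, v))).
Proof.
move=> mg.
exact: (measurableT_comp mg (measurableT_comp (@measurable_cons_row n) (measurable_pair1 x))).
Qed.

Lemma measurable_lebesgue_int n (g : 'rV[R]_n.+1 -> \bar R) :
  measurable_fun [set: 'rV[R]_n.+1] g -> (forall x, 0 <= g x) ->
  measurable_fun [set: measurableTypeR R]
    (fun x : R => lebesgue_int (fun v => g (cons_row (x, v)))).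
Proof.
move=> mg g0.
rewrite (_ : (fun x => _) = fubini_F (vol n) (g \o @cons_row n)).
  apply: measurable_fun_fubini_tonelli_F => //.
  exact: (measurableT_comp mg (@measurable_cons_row n)).
  by move=> x; exact: g0.
apply/funext => x; rewrite lebesgue_intE//.
exact: measurable_slice.
Qed.

Lemma lebesgue_int_ge0 n (g : 'rV[R]_n -> \bar R) :
  (forall x, 0 <= g x) -> 0 <= lebesgue_int g.
Proof.
elim: n g => [|n IH] g g0 //=.
by apply: integral_ge0 => x _; apply: IH.
Qed.

(** Iterated integration reduces the translation by a vector to translations of
    the line, one coordinate at a time. *)
Lemma lebesgue_int_shift n (a : 'rV[R]_n) (g : 'rV[R]_n -> \bar R) :
  measurable_fun [set: 'rV[R]_n] g -> (forall x, 0 <= g x) ->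
  lebesgue_int (fun x => g (x + a)%R) = lebesgue_int g.
Proof.
elim: n a g => [|n IH] a g mg g0 /=; first by congr g; apply/rowP => -[].
transitivity (\int[leb]_x
    lebesgue_int (fun v => g (cons_row ((x + (uncons_row a).1)%R, v)))).
  apply: eq_integral => x _.
  rewrite -(IH (uncons_row a).2 (fun v => g (cons_row ((x + (uncons_row a).1)%R, v))))//.
    by congr lebesgue_int; apply/funext => v; rewrite -[LHS]/(g (cons_row (x, v) + a)%R) cons_row_add.
  exact: measurable_slice.
apply: (@lebesgue_shift _ (fun x => lebesgue_int (fun v => g (cons_row (x, v))))) => [|x].
  exact: measurable_lebesgue_int.
exact: lebesgue_int_ge0.
Qed.

Lemma vol_shift n (a : 'rV[R]_n) (g : 'rV[R]_n -> \bar R) :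
  measurable_fun [set: 'rV[R]_n] g -> (forall x, 0 <= g x) ->
  \int[vol n]_x g (x + a)%R = \int[vol n]_x g x.
Proof.
move=> mg g0; rewrite -!lebesgue_intE// ?lebesgue_int_shift//.
exact: (measurableT_comp mg (measurable_addr a)).
Qed.

(** Cubes are the sets whose volume the iterated integral gives at once; they
    bound the volume of the unit ball from both sides. *)
Definition cube n (r : R) := [set x : 'rV[R]_n | forall i, (`|x 0%R i| <= r)%R].

Lemma measurable_cube n r : measurable (@cube n r).
Proof.
rewrite (_ : cube r = \bigcap_(i in [set: 'I_n])
    ((fun x : 'rV[R]_n => x 0%R i) @^-1` `[(- r)%R, r]%classic)).
  apply: fin_bigcap_measurable => // i _.
  rewrite -[X in measurable X]setTI; apply: measurable_coord => //.
apply/seteqP; split => x /=.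
  by move=> H i _ /=; rewrite in_itv/= -ler_norml.
by move=> H i; have := H i I; rewrite /= in_itv/= -ler_norml.
Qed.

Lemma lebesgue_int_cube n (r : R) : (0 <= r)%R ->
  lebesgue_int (fun x => (\1_(@cube n r) x)%:E) = ((r *+ 2) ^+ n)%:E.
Proof.
move=> r0; elim: n => [|n IH] /=.
  by rewrite expr0 indicE mem_set// => -[].
transitivity (\int[leb]_x ((\1_`[(- r)%R, r] x)%:E * ((r *+ 2) ^+ n)%:E)).
  apply: eq_integral => x _; rewrite -IH.
  rewrite [in RHS]indicE; case: (boolP (x \in _)) => xr.
    rewrite mul1e; congr lebesgue_int; apply/funext => v; congr EFin.
    rewrite !indicE; congr (_%:R); congr (nat_of_bool _).
    have xr' : (`|x| <= r)%R.
      by move: xr; rewrite inE/= in_itv/= -ler_norml.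
    apply/idP/idP; rewrite !inE => H i.
      by have := H (lift ord0 i); rewrite (cons_rowS (x, v)).
    case: (unliftP ord0 i) => [j ->|->].
      by rewrite (cons_rowS (x, v)); exact: H.
    by rewrite (cons_row0 (x, v)).
  rewrite mul0e; transitivity (lebesgue_int (fun _ : 'rV[R]_n => 0 : \bar R)).
    congr lebesgue_int; apply/funext => v.
    rewrite indicE memNset// => H; move/negP: xr; apply.
    have := H ord0; rewrite (cons_row0 (x, v))/= => xr.
    by rewrite inE/= in_itv/= -ler_norml.
  by rewrite lebesgue_intE// integral0.
rewrite ge0_integralZr//; last 2 first.
  by apply/measurable_EFinP.
  by rewrite lee_fin exprn_ge0// mulrn_wge0.
rewrite integral_indic// setIT [X in X * _](lebesgue_measure_itv `[(- r)%R, r])/= lte_fin.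
rewrite exprS EFinM; congr (_ * _).
rewrite opprK; case: ltP => // rr; congr EFin.
have -> : r = 0%R by lra.
by rewrite mul0rn.
Qed.

Lemma measurable_dotp n (T : 'rV[R]_n) :
  measurable_fun [set: 'rV[R]_n] (fun x => dotp x T).
Proof.
rewrite /dotp; apply: measurable_sum => i.
by apply: measurable_funM => //; exact: measurable_coord.
Qed.

Lemma measurable_hyperplane n (T : 'rV[R]_n) (c : R) :
  measurable [set x | dotp x T = c].
Proof.
rewrite -[X in measurable X]setTI.
exact: (@measurable_dotp n T _ [set c]).
Qed.

(** Affine hyperplanes are treated for the sake of the induction: the slices of
    a hyperplane are affine hyperplanes, except when the normal vector is along
    the first axis; then only one slice is nonempty. *)
Lemma lebesgue_int_hyperplane n (T : 'rV[R]_n) (c : R) : T != 0%R ->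
  lebesgue_int (fun x => (\1_[set x | dotp x T = c] x)%:E) = 0.
Proof.
elim: n T c => [|n IH] T c T0 /=.
  by move/eqP: T0; case; apply/rowP => -[].
have dE x v : (dotp (cons_row (x, v)) T = x * (uncons_row T).1 + dotp v (uncons_row T).2)%R.
  rewrite /dotp big_ord_recl cons_row0; congr (_ + _)%R.
  apply: eq_bigr => i _; rewrite cons_rowS/= mxE; congr (_ * T 0 _)%R; exact: val_inj.
have [T'0|T'0] := eqVneq (uncons_row T).2 0%R; last first.
  rewrite -[RHS](integral0 leb setT); apply: eq_integral => x _.
  rewrite -(IH _ (c - x * (uncons_row T).1)%R T'0).
  congr lebesgue_int; apply/funext => v; congr EFin.
  rewrite !indicE; congr (_%:R); congr (nat_of_bool _).
  apply/idP/idP; rewrite !inE/= dE => H.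
    by rewrite -H addrC addKr.
  by rewrite H addrC subrK.
have t0 : (uncons_row T).1 != 0%R.
  apply: contraNneq T0 => t0; apply/eqP/rowP => i; rewrite mxE.
  case: (unliftP ord0 i) => [j ->|->]; last exact: t0.
  have /rowP/(_ j) := T'0; rewrite !mxE => <-; congr (T 0%R _); exact: val_inj.
rewrite -[RHS](integral0 leb setT); apply: ge0_ae_eq_integral => //.
- apply: (@measurable_lebesgue_int _
    (fun x => (\1_[set x | dotp x T = c] x)%:E)) => [|x]; last by rewrite lee_fin.
  by apply/measurable_EFinP; apply: measurable_indic; exact: measurable_hyperplane.
- by move=> x _; apply: lebesgue_int_ge0 => v; rewrite lee_fin.
exists [set (c / (uncons_row T).1)%R]; split => //; first exact: lebesgue_measure_set1.
move=> x /= nx; apply: contrapT => xc; apply: nx => _.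
transitivity (lebesgue_int (fun _ : 'rV[R]_n => 0 : \bar R)).
  congr lebesgue_int; apply/funext => v; rewrite indicE memNset//= dE.
  rewrite T'0 => H; apply: xc; rewrite -H.
  have -> : (dotp v 0 = 0)%R by rewrite /dotp big1// => i _; rewrite mxE mulr0.
  by rewrite addr0 mulfK.
by rewrite lebesgue_intE// integral0.
Qed.

End Volume.

(** * The Euclidean inner product *)

Section InnerProduct.
Variables (R : realType) (n : nat).
Implicit Types (u v w : 'rV[R]_n) (a : R).

Lemma dotpE u v : dotp u v = (u *m v^T) 0 0.
Proof. by rewrite mxE; apply: eq_bigr => i _; rewrite mxE. Qed.

Lemma dotpC u v : dotp u v = dotp v u.
Proof. by apply: eq_bigr => i _; rewrite mulrC. Qed.

Lemma dotpDl u v w : dotp (u + v) w = dotp u w + dotp v w.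
Proof. by rewrite !dotpE mulmxDl mxE. Qed.

Lemma dotpZl a u w : dotp (a *: u) w = a * dotp u w.
Proof. by rewrite !dotpE -scalemxAl mxE. Qed.

Lemma dotpNl u w : dotp (- u) w = - dotp u w.
Proof. by rewrite -scaleN1r dotpZl mulN1r. Qed.

Lemma dotpDr u v w : dotp w (u + v) = dotp w u + dotp w v.
Proof. by rewrite dotpC dotpDl !(dotpC w). Qed.

Lemma dotpZr a u w : dotp w (a *: u) = a * dotp w u.
Proof. by rewrite dotpC dotpZl dotpC. Qed.

Lemma dotpNr u w : dotp w (- u) = - dotp w u.
Proof. by rewrite dotpC dotpNl dotpC. Qed.

Lemma dotp0l w : dotp 0 w = 0.
Proof. by rewrite -(scale0r 0) dotpZl mul0r. Qed.

Lemma dotp_ge0 u : 0 <= dotp u u.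
Proof. by apply: sumr_ge0 => i _; rewrite -expr2 sqr_ge0. Qed.

Lemma dotp_eq0 u : (dotp u u == 0) = (u == 0).
Proof.
apply/eqP/eqP => [|->]; last exact: dotp0l.
move=> H; apply/rowP => i; rewrite mxE; apply/eqP.
rewrite -sqrf_eq0 expr2; apply/eqP.
by apply: (psumr_eq0P _ H) => // j _; rewrite -expr2 sqr_ge0.
Qed.

Lemma enorm_ge0 u : 0 <= enorm u.
Proof. exact: sqrtr_ge0. Qed.

Lemma enorm_sqr u : enorm u ^+ 2 = dotp u u.
Proof. by rewrite sqr_sqrtr// dotp_ge0. Qed.

Lemma enorm_eq0 u : (enorm u == 0) = (u == 0).
Proof. by rewrite -dotp_eq0 -enorm_sqr sqrf_eq0. Qed.

Lemma enorm_gt0 u : (0 < enorm u) = (u != 0).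
Proof. by rewrite lt_neqAle enorm_ge0 andbT eq_sym enorm_eq0. Qed.

Lemma enormN u : enorm (- u) = enorm u.
Proof. by rewrite /enorm dotpNl dotpNr opprK. Qed.

Lemma enormZ a u : 0 <= a -> enorm (a *: u) = a * enorm u.
Proof.
move=> a0; rewrite /enorm dotpZl dotpZr mulrA -expr2 sqrtrM ?sqr_ge0//.
by rewrite sqrtr_sqr ger0_norm.
Qed.

Lemma enorm_normalize u : u != 0 -> enorm (normalize u) = 1.
Proof.
move=> u0; rewrite /normalize enormZ ?invr_ge0 ?enorm_ge0//.
by rewrite mulVf// enorm_eq0.
Qed.

(** Cauchy-Schwarz for a unit vector: v minus its projection on u has a
    nonnegative square. *)
Lemma dotp_le_enorm u v : enorm u = 1 -> dotp u v <= enorm v.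
Proof.
move=> u1; have uu : dotp u u = 1 by rewrite -enorm_sqr u1 expr1n.
have := dotp_ge0 (v - dotp u v *: u).
rewrite dotpDl !dotpDr !dotpNl !dotpNr !dotpZl !dotpZr uu (dotpC v u).
rewrite -enorm_sqr => H.
have := enorm_ge0 v; nra.
Qed.

Lemma enorm_le1 u : (enorm u <= 1) = (dotp u u <= 1).
Proof. by rewrite -enorm_sqr expr_le1// enorm_ge0. Qed.

Lemma dotp_orth (A : 'M[R]_n) u v : A *m A^T = 1%:M ->
  dotp (u *m A) (v *m A) = dotp u v.
Proof. by move=> AA; rewrite !dotpE trmx_mul mulmxA -(mulmxA u) AA mulmx1. Qed.

Lemma enorm_orth (A : 'M[R]_n) u : A *m A^T = 1%:M -> enorm (u *m A) = enorm u.
Proof. by move=> AA; rewrite /enorm dotp_orth. Qed.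

End InnerProduct.

(** * Invariance of volume under orthogonal maps *)

Section Sphere.
Variables (R : realType) (n : nat).
Notation vol := (@vol R n).
Local Open Scope ereal_scope.

Definition unit_ball := [set x : 'rV[R]_n | (enorm x <= 1)%R].

Lemma measurable_mulmxr (A : 'M[R]_n) :
  measurable_fun [set: 'rV[R]_n] (fun x : 'rV[R]_n => x *m A).
Proof.
apply: measurable_fun_row => i; under eq_fun do rewrite mxE.
apply: measurable_sum => j.
by apply: measurable_funM => //; exact: measurable_coord.
Qed.

Lemma measurable_unit_ball : measurable unit_ball.
Proof.
rewrite (_ : unit_ball = (fun x => dotp x x) @^-1` `]-oo, 1%R]).
  rewrite -[X in measurable X]setTI.
  have m : measurable_fun [set: 'rV[R]_n] (fun x => dotp x x); last exact: m.
  apply: measurable_sum => i.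
  by apply: measurable_funM => //; exact: measurable_coord.
by apply/seteqP; split => x; rewrite /unit_ball /= in_itv/= enorm_le1.
Qed.

Lemma unit_ball_cube : unit_ball `<=` cube 1%R.
Proof.
move=> x; rewrite /unit_ball /= enorm_le1 => H i.
rewrite -(@expr_le1 _ 2)//; apply: le_trans H.
rewrite real_normK ?num_real// /dotp (bigD1 i)//= -expr2 lerDl.
by apply: sumr_ge0 => j _; rewrite -expr2 sqr_ge0.
Qed.

Lemma cube_unit_ball : @cube R n (n.+1%:R^-1)%R `<=` unit_ball.
Proof.
move=> x H; rewrite /unit_ball /= enorm_le1 /dotp.
apply: (@le_trans _ _ (\sum_(i < n) n.+1%:R^-1)%R).
  apply: ler_sum => i _; rewrite -expr2 -real_normK ?num_real// expr2.
  have n1 : (n.+1%:R^-1 <= 1 :> R)%R by rewrite invf_le1// ler1n.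
  apply: (@le_trans _ _ (n.+1%:R^-1 * 1)%R); last by rewrite mulr1.
  by apply: ler_pM => //; exact: le_trans (H i) n1.
rewrite sumr_const card_ord -[X in (X <= _)%R]mulr_natr mulrC.
by rewrite ler_pdivrMr// mul1r ler_nat.
Qed.

Lemma vol_cube r : (0 <= r)%R -> vol (cube r) = ((r *+ 2) ^+ n)%:E.
Proof.
move=> r0; rewrite -(lebesgue_int_cube n r0) lebesgue_intE.
- by rewrite integral_indic ?setIT//; exact: measurable_cube.
- by apply/measurable_EFinP; apply: measurable_indic; exact: measurable_cube.
- by move=> x; rewrite lee_fin.
Qed.

Lemma vol_unit_ball_gt0 : 0 < vol unit_ball.
Proof.
apply: (@lt_le_trans _ _ (vol (cube n.+1%:R^-1)%R)).
  by rewrite vol_cube// lte_fin exprn_gt0// mulrn_wgt0// invr_gt0.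
apply: le_measure; last exact: cube_unit_ball.
  by rewrite inE; exact: measurable_cube.
by rewrite inE; exact: measurable_unit_ball.
Qed.

Lemma vol_unit_ball_lty : vol unit_ball < +oo.
Proof.
apply: (@le_lt_trans _ _ (vol (cube 1%R))).
  apply: le_measure; last exact: unit_ball_cube.
    by rewrite inE; exact: measurable_unit_ball.
  by rewrite inE; exact: measurable_cube.
by rewrite vol_cube// ltry.
Qed.

(** The uniqueness argument for Haar measure, which avoids any factorization of
    the matrix.  Let b be the indicator of the unit ball.  The double integral of
    b(x) g(y A) is computed in two ways: translate y by x A^T, so that the
    integrand becomes b(x) g(x + y A); exchange the integrals; translate x by
    - y A, which gives b(x - y A) g(x).  As A preserves the ball, the integral of
    b(x - y A) over y is again the volume of the ball, and this factor, positive
    and finite, cancels. *)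
Lemma vol_orth (A : 'M[R]_n) (g : 'rV[R]_n -> \bar R) : A *m A^T = 1%:M ->
  measurable_fun [set: 'rV[R]_n] g -> (forall x, 0 <= g x) ->
  \int[vol]_x g (x *m A) = \int[vol]_x g x.
Proof.
move=> AA mg g0.
have A'A : A^T *m A = 1%:M by apply: mulmx1C.
pose b (x : 'rV[R]_n) := (\1_unit_ball x)%:E : \bar R.
have b0 x : 0 <= b x by rewrite lee_fin.
have mb : measurable_fun [set: 'rV[R]_n] b.
  by apply/measurable_EFinP; apply: measurable_indic; exact: measurable_unit_ball.
have Ib : \int[vol]_x b x = vol unit_ball.
  by rewrite integral_indic ?setIT//; exact: measurable_unit_ball.
have mgA : measurable_fun [set: 'rV[R]_n] (fun x => g (x *m A)).
  exact: (measurableT_comp mg (measurable_mulmxr A)).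
have mfst : measurable_fun [set: 'rV[R]_n * 'rV[R]_n] (fun z => z.1).
  exact: measurable_fst.
have madd (s : R) : measurable_fun [set: 'rV[R]_n * 'rV[R]_n]
    (fun z => z.1 + s *: (z.2 *m A))%R.
  apply: measurable_fun_row => i; under eq_fun do rewrite !mxE.
  apply: measurable_funD.
    by apply: (measurableT_comp (@measurable_coord R n i) mfst).
  apply: measurable_funM => //.
  apply: measurable_sum => j; apply: measurable_funM => //.
  exact: (measurableT_comp (@measurable_coord R n j) measurable_snd).
(* The common factor is cancelled first, so that only the double integrals
   have to be compared. *)
suff H : vol unit_ball * \int[vol]_y g (y *m A) = vol unit_ball * \int[vol]_x g x.
  have := congr1 (fun z => (fine (vol unit_ball))^-1%:E * z) H.
  have bf : vol unit_ball \is a fin_num.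
    by rewrite ge0_fin_numE ?measure_ge0// vol_unit_ball_lty.
  have bn0 : fine (vol unit_ball) != 0%R.
    by rewrite gt_eqF// fine_gt0// vol_unit_ball_gt0 vol_unit_ball_lty.
  rewrite !muleA -{2 4}(fineK bf) -!EFinM mulVf//.
  by rewrite !mul1e.
transitivity (\int[vol]_x \int[vol]_y (b x * g (x + y *m A)%R)).
  rewrite -Ib -ge0_integralZr//; last by apply: integral_ge0.
  apply: eq_integral => x _; rewrite ge0_integralZl//.
    congr (_ * _); rewrite -(vol_shift (x *m A^T) mgA)//.
    by apply: eq_integral => y _; rewrite mulmxDl -mulmxA A'A mulmx1 addrC.
  apply: (measurableT_comp mg); apply: measurable_fun_row => i.
  under eq_fun do rewrite mxE.
  apply: measurable_funD => //.
  exact: (measurableT_comp (@measurable_coord R n i) (measurable_mulmxr A)).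
pose f z := b z.1 * g (z.1 + z.2 *m A)%R.
have mf : measurable_fun [set: 'rV[R]_n * 'rV[R]_n] f.
  apply: emeasurable_funM; first exact: (measurableT_comp mb mfst).
  apply: (measurableT_comp mg).
  by have := madd 1%R; under eq_fun do rewrite scale1r.
rewrite (@fubini_tonelli _ _ _ _ R vol vol f mf); last by move=> z; rewrite mule_ge0.
transitivity (\int[vol]_y \int[vol]_x (b (x - y *m A)%R * g x)).
  apply: eq_integral => y _.
  rewrite -[RHS](vol_shift (y *m A)%R) => [||x]; last by rewrite mule_ge0.
    by apply: eq_integral => x _; rewrite addrK.
  apply: emeasurable_funM => //.
  exact: (measurableT_comp mb (measurable_addr _)).
pose f' z := b (z.1 - z.2 *m A)%R * g z.1.
have mf' : measurable_fun [set: 'rV[R]_n * 'rV[R]_n] f'.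
  apply: emeasurable_funM; last exact: (measurableT_comp mg mfst).
  apply: (measurableT_comp mb).
  by have := madd (-1)%R; under eq_fun do rewrite scaleN1r.
rewrite -(@fubini_tonelli _ _ _ _ R vol vol f' mf'); last by move=> z; rewrite mule_ge0.
rewrite -ge0_integralZl//.
apply: eq_integral => x _; rewrite /f'/= ge0_integralZr//.
  congr (_ * _); rewrite -Ib -(vol_shift (- (x *m A^T))%R mb b0).
  apply: eq_integral => y _; rewrite /b; congr EFin; rewrite !indicE.
  have E : enorm (x - y *m A) = enorm (y - x *m A^T).
    rewrite -[RHS](enorm_orth _ AA) mulmxBl -mulmxA A'A mulmx1 -enormN.
    by rewrite opprB.
  congr (_%:R); congr (nat_of_bool _).
  by apply/idP/idP; rewrite !inE /unit_ball/= E.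
apply: (measurableT_comp mb); apply: measurable_fun_row => i.
under eq_fun do rewrite !mxE.
apply: measurable_funB => //; apply: measurable_sum => j.
by apply: measurable_funM => //; exact: measurable_coord.
Qed.

End Sphere.

(** * The law of a uniform random direction *)

Section SphereProbability.
Variables (R : realType) (n : nat).
Notation vol := (@vol R n).
Notation ball := (@unit_ball R n).
Local Open Scope ereal_scope.

Let mball := @measurable_unit_ball R n.

Let ball_fin : vol ball \is a fin_num.
Proof. by rewrite ge0_fin_numE ?measure_ge0// vol_unit_ball_lty. Qed.

Let ball_gt0 : (0 < fine (vol ball))%R.
Proof. by rewrite fine_gt0// vol_unit_ball_gt0 vol_unit_ball_lty. Qed.

Let scale_ge0 : (0 <= (fine (vol ball))^-1)%R.
Proof. by rewrite invr_ge0 ltW. Qed.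

(** The uniform law on the unit ball.  Only its values on cones matter, and on
    them it agrees with the uniform law on the sphere; working in the ball keeps
    the directions in the vector space. *)
Definition direction_law : set 'rV[R]_n -> \bar R :=
  mscale (NngNum scale_ge0) (mrestr vol mball).

HB.instance Definition _ := Measure.on direction_law.

Let direction_law_setT : direction_law setT = 1.
Proof.
rewrite /direction_law /mscale/= /mrestr setTI -(fineK ball_fin).
by rewrite -EFinM mulVf// gt_eqF.
Qed.

HB.instance Definition _ :=
  Measure_isProbability.Build _ _ _ direction_law direction_law_setT.

Lemma integral_direction_law (h : 'rV[R]_n -> \bar R) :
  measurable_fun [set: 'rV[R]_n] h -> (forall x, 0 <= h x) ->
  \int[direction_law]_x h x =
  (fine (vol ball))^-1%:E * \int[vol]_x ((\1_ball x)%:E * h x).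
Proof.
move=> mh h0.
transitivity ((fine (vol ball))^-1%:E * \int[mrestr vol mball]_x h x).
  exact: ge0_integral_mscale.
congr (_ * _).
transitivity (\int[mrestr vol mball]_(x in ball) h x).
  have -> : [set: 'rV[R]_n] = ball `|` ~` ball by rewrite setUv.
  rewrite ge0_integral_setU//; last 3 first.
  - exact: measurableC.
  - by rewrite setUv.
  - by apply/disj_setPCl.
  rewrite [X in _ + X](_ : _ = 0) ?adde0//.
  apply: null_set_integral => //=; first exact: measurableC.
    exact: measurable_funTS.
  by rewrite /mrestr setICl measure0.
rewrite [LHS](_ : _ = \int[vol]_(x in ball) h x); last first.
  apply: eq_measure_integral => A mA AB.
  by rewrite /= /mrestr (setIidl AB).
rewrite integral_mkcond; apply: eq_integral => x _.
by rewrite patchE indicE; case: (x \in ball); rewrite ?mul1e ?mul0e.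
Qed.

(** The hypothesis on normalize says that h depends on the direction only; this
    holds for functions of the signs of inner products. *)
Lemma sphere_meanE (h : 'rV[R]_n -> R) :
  measurable_fun [set: 'rV[R]_n] h -> (forall x, 0 <= h x)%R ->
  (forall x, h (normalize x) = h x) ->
  sphere_mean h = fine (\int[direction_law]_x (h x)%:E).
Proof.
move=> mh h0 hn; rewrite /sphere_mean.
rewrite integral_direction_law; last 2 first.
- exact/measurable_EFinP.
- by move=> x; rewrite lee_fin.
rewrite [X in (_ / fine X)%R]lebesgue_intE; last 2 first.
- by apply/measurable_EFinP; apply: measurable_indic.
- by move=> x; rewrite lee_fin.
rewrite integral_indic// setIT.
rewrite lebesgue_intE; last 2 first.
- apply/measurable_EFinP; apply: measurable_funM.
    exact: measurable_indic.
  by under eq_fun do rewrite hn.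
- by move=> x; rewrite lee_fin mulr_ge0// hn.
under eq_integral do rewrite hn EFinM.
set I := \int[_]_x _.
have I0 : 0 <= I by apply: integral_ge0 => x _; rewrite mule_ge0 ?lee_fin.
have k0 : (0 < (fine (vol ball))^-1)%R by rewrite invr_gt0.
case: I I0 => [r| |]//= _; first by rewrite mulrC.
by rewrite mulry gtr0_sg// mul1e mul0r.
Qed.

Lemma direction_law_orth (A : 'M[R]_n) (S : set 'rV[R]_n) : A *m A^T = 1%:M ->
  measurable S -> direction_law [set x | S (x *m A)] = direction_law S.
Proof.
move=> AA mS; rewrite /direction_law /mscale /= /mrestr; congr (_ * _).
have mSB : measurable (S `&` ball) by exact: measurableI.
have mSA : measurable ([set x : 'rV[R]_n | S (x *m A)] `&` ball).
  apply: measurableI => //; rewrite -[X in measurable X]setTI.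
  exact: (@measurable_mulmxr R n A).
have E X : measurable X -> vol X = \int[vol]_x (\1_X x)%:E.
  by move=> mX; rewrite integral_indic// setIT.
rewrite (E _ mSA) (E _ mSB).
rewrite -(@vol_orth _ _ A (fun x => (\1_(S `&` ball) x)%:E) AA); last 2 first.
- by apply/measurable_EFinP; apply: measurable_indic.
- by move=> x; rewrite lee_fin.
apply: eq_integral => x _; congr EFin; rewrite !indicE.
congr (_%:R); congr (nat_of_bool _).
by apply/idP/idP; rewrite !inE /unit_ball/= enorm_orth.
Qed.

Lemma direction_law_hyperplane (T : 'rV[R]_n) : T != 0%R ->
  direction_law [set x | dotp x T = 0%R] = 0.
Proof.
move=> T0; have mH := measurable_hyperplane T 0%R.
have H0 : vol [set x | dotp x T = 0%R] = 0.
  rewrite -[RHS](lebesgue_int_hyperplane 0%R T0) lebesgue_intE.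
  - by rewrite integral_indic ?setIT.
  - by apply/measurable_EFinP; apply: measurable_indic.
  - by move=> x; rewrite lee_fin.
have H1 : vol ([set x | dotp x T = 0%R] `&` ball) = 0.
  by apply: (@subset_measure0 _ _ _ _ _ [set x | dotp x T = 0%R]) => //;
    exact: measurableI.
by rewrite /direction_law /mscale /= /mrestr H1 mule0.
Qed.

End SphereProbability.

(** * The probability of separating two vectors *)

Section Separation.
Variables (R : realType) (n : nat).
Implicit Types (u v x : 'rV[R]_n) (A : set 'rV[R]_n).

Definition prob A : R := fine (direction_law A).

Lemma probE A : measurable A -> (prob A)%:E = direction_law A.
Proof. by move=> mA; rewrite fineK// fin_num_measure. Qed.

Lemma prob_ge0 A : 0 <= prob A.
Proof. by apply: fine_ge0; exact: measure_ge0. Qed.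

Lemma prob_le1 A : measurable A -> prob A <= 1.
Proof. by move=> mA; rewrite -lee_fin probE// probability_le1. Qed.

Lemma prob_sub A B : measurable A -> measurable B -> A `<=` B -> prob A <= prob B.
Proof.
by move=> mA mB AB; rewrite -lee_fin !probE//; apply: le_measure; rewrite ?inE.
Qed.

Lemma prob_disjU A B : measurable A -> measurable B -> A `&` B = set0 ->
  prob (A `|` B) = prob A + prob B.
Proof.
move=> mA mB AB; apply: EFin_inj; rewrite EFinD !probE ?measureU//.
exact: measurableU.
Qed.

Lemma prob_orth (M : 'M[R]_n) A : M *m M^T = 1%:M ->
  measurable A -> prob [set x | A (x *m M)] = prob A.
Proof. by move=> MM mA; rewrite /prob direction_law_orth. Qed.

(** The directions whose orthogonal hyperplane separates u and v. *)
Definition sep u v : set 'rV[R]_n := [set x | dotp x u * dotp x v < 0].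

Lemma measurable_sep u v : measurable (sep u v).
Proof.
rewrite (_ : sep u v = (fun x => dotp x u * dotp x v) @^-1` `]-oo, 0[).
  rewrite -[X in measurable X]setTI.
  have m : measurable_fun [set: 'rV[R]_n] (fun x => dotp x u * dotp x v).
    by apply: measurable_funM; exact: measurable_dotp.
  exact: m.
by apply/seteqP; split => x; rewrite /sep/= in_itv.
Qed.

Lemma sepC u v : sep u v = sep v u.
Proof. by apply/seteqP; split => x; rewrite /sep/= mulrC. Qed.

(** The points u, v, ... that follow each other at equal distances on the great
    circle through the unit vectors u and v.  The Chebyshev recursion
    w(k+2) = 2 cos(t) w(k+1) - w(k) produces them without an orthonormal basis of
    the plane and is meaningful also if u and v are collinear. *)
Fixpoint circle_steps u v (k : nat) : 'rV[R]_n * 'rV[R]_n :=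
  if k is k'.+1 then
    let: (a, b) := circle_steps u v k' in (b, 2 * dotp u v *: b - a)
  else (u, v).

Definition circle_point u v k := (circle_steps u v k).1.

Lemma circle_point0 u v : circle_point u v 0 = u. Proof. by []. Qed.

Lemma circle_point1 u v : circle_point u v 1 = v. Proof. by []. Qed.

Lemma circle_pointSS u v k : circle_point u v k.+2 = 2 * dotp u v *: circle_point u v k.+1 - circle_point u v k.
Proof. by rewrite /circle_point /=; case: (circle_steps u v k). Qed.

Lemma circle_point_dot u v k : enorm u = 1 -> enorm v = 1 ->
  dotp (circle_point u v k) (circle_point u v k) = 1 /\ dotp (circle_point u v k.+1) (circle_point u v k.+1) = 1 /\
  dotp (circle_point u v k) (circle_point u v k.+1) = dotp u v.
Proof.
move=> u1 v1; elim: k => [|k [IH0 [IH1 IH]]].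
  by rewrite circle_point0 circle_point1 -!enorm_sqr u1 v1 expr1n.
split=> //; rewrite circle_pointSS; set a := circle_point u v k; set b := circle_point u v k.+1.
rewrite -/a -/b in IH0 IH1 IH.
rewrite !(dotpDl, dotpDr, dotpNl, dotpNr, dotpZl, dotpZr).
rewrite (dotpC b a) IH0 IH1 IH; split; ring.
Qed.

(** The isometry that fixes the line of the unit vector u and is - 1 on its
    orthogonal complement. *)
Definition line_reflection u : 'M[R]_n := 2 *: (u^T *m u) - 1%:M.

Lemma line_reflection_tr u : (line_reflection u)^T = line_reflection u.
Proof. by rewrite /line_reflection linearB/= linearZ/= trmx_mul trmxK trmx1. Qed.

Lemma line_reflectionE u x : x *m line_reflection u = 2 * dotp x u *: u - x.
Proof.
rewrite /line_reflection mulmxBr mulmx1 -scalemxAr mulmxA.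
by rewrite [x *m u^T]mx11_scalar -dotpE mul_scalar_mx scalerA.
Qed.

Lemma line_reflection_orth u : dotp u u = 1 -> line_reflection u *m (line_reflection u)^T = 1%:M.
Proof.
move=> uu; rewrite line_reflection_tr; apply/row_matrixP => i.
rewrite !row_mul !rowE mulmx1 -mulmxA; set e := delta_mx _ _.
rewrite mulmxA !line_reflectionE !(dotpDl, dotpNl, dotpZl) uu.
rewrite opprB addrCA -scalerBl (_ : _ - _ = 0) ?scale0r ?addr0//; ring.
Qed.

(** The isometry fixing w(k+1) exchanges its neighbours w(k) and w(k+2). *)
Lemma prob_sep_circle_point u v k : enorm u = 1 -> enorm v = 1 ->
  prob (sep (circle_point u v k) (circle_point u v k.+1)) = prob (sep u v).
Proof.
move=> u1 v1; elim: k => [//|k IH]; rewrite -IH.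
have [_ [bb ab]] := circle_point_dot k u1 v1.
set a := circle_point u v k; set b := circle_point u v k.+1; rewrite -/a -/b in bb ab IH.
rewrite -(prob_orth (line_reflection_orth bb) (measurable_sep a b)) sepC.
congr prob; apply/seteqP; split => x; rewrite /sep/= circle_pointSS line_reflectionE.
  rewrite !(dotpDl, dotpDr, dotpNl, dotpNr, dotpZl, dotpZr) bb (dotpC b a) ab -/a -/b.
  by apply: le_lt_trans; rewrite le_eqVlt; apply/orP; left; apply/eqP; ring.
rewrite !(dotpDl, dotpDr, dotpNl, dotpNr, dotpZl, dotpZr) bb (dotpC b a) ab -/a -/b.
by apply: le_lt_trans; rewrite le_eqVlt; apply/orP; left; apply/eqP; ring.
Qed.

(** Any three vectors at angles 0, kt and (k+1)t in a plane satisfy this relation;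
    the recursion of circle_point is that of sin (k t). *)
Lemma circle_point_sin u v (t : R) k x : dotp u v = cos t ->
  sin (k.+1%:R * t) * dotp x (circle_point u v k) =
  sin t * dotp x u + sin (k%:R * t) * dotp x (circle_point u v k.+1).
Proof.
move=> uv; elim: k => [|k IH].
  by rewrite mul1r mul0r sin0 mul0r addr0 circle_point0.
have E : sin (k.+2%:R * t) = 2 * cos t * sin (k.+1%:R * t) - sin (k%:R * t).
  have -> : k.+2%:R * t = k.+1%:R * t + t by rewrite -(natr1 k.+1); ring.
  have -> : k%:R * t = k.+1%:R * t - t by rewrite -natr1; ring.
  by rewrite sinD sinB; ring.
rewrite E circle_pointSS dotpDr dotpNr dotpZr uv.
rewrite mulrBr mulrBl.
rewrite [X in _ = _ + (_ - X)]IH; ring.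
Qed.

(** Probability of separation is superadditive along half a great circle.  Write f,
    g, h for the inner products of x with u, w(k) and w(k+1).  The relation
    a g = b f + d h with a >= 0 and b, d > 0 forbids that g has the sign opposite
    to those of both f and h; so the events (f, g separated) and (g, h separated)
    are disjoint, and each of them implies that f and h are separated. *)
Lemma prob_sep_le u v (t : R) k : enorm u = 1 -> enorm v = 1 ->
  dotp u v = cos t -> 0 < t -> k.+1%:R * t <= pi ->
  k.+1%:R * prob (sep u v) <= prob (sep u (circle_point u v k.+1)).
Proof.
move=> u1 v1 uv t0; elim: k => [|k IH] kt; first by rewrite mul1r.
have kt' : k.+1%:R * t < pi.
  by apply: lt_le_trans kt; rewrite ltr_pM2r// ltr_nat.
rewrite -natr1 mulrDl mul1r.
apply: (@le_trans _ _ (prob (sep u (circle_point u v k.+1)) +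
                       prob (sep (circle_point u v k.+1) (circle_point u v k.+2)))).
  by rewrite prob_sep_circle_point// lerD2r; apply: IH; exact: ltW.
have a0 : 0 <= sin (k.+2%:R * t).
  by apply: sin_ge0_pi; rewrite kt andbT mulr_ge0// ltW.
have d0 : 0 < sin (k.+1%:R * t) by apply: sin_gt0_pi; rewrite kt' andbT mulr_gt0.
have b0 : 0 < sin t.
  apply: sin_gt0_pi; rewrite t0/=; apply: le_lt_trans kt'.
  by rewrite -[X in X <= _]mul1r ler_wpM2r ?ler1n// ltW.
(* The coefficients a, d, b of the relation between the three inner products. *)
have E x := circle_point_sin k.+1 x uv.
set w := circle_point u v k.+1 in E *; set z := circle_point u v k.+2 in E *.
rewrite -prob_disjU; [|exact: measurable_sep|exact: measurable_sep|].
- apply: prob_sub; [by apply: measurableU; exact: measurable_sep|exact: measurable_sep|].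
  move=> x; have := E x; rewrite /sep /setU /=.
  set f := dotp x u; set g := dotp x w; set h := dotp x z.
  move: a0 d0 b0; set a := sin _; set d := sin _; set b := sin _ => a0 d0 b0 Ex [fg|gh].
    have f0 : 0 < f * f.
      rewrite -expr2 exprn_even_gt0//=; apply: contraTneq fg => ->.
      by rewrite mul0r ltxx.
    have K : d * (f * h) = a * (f * g) - b * (f * f).
      transitivity (f * (a * g) - b * (f * f)); last by ring.
      by rewrite Ex; ring.
    rewrite -(pmulr_rlt0 _ d0) K; nra.
  have h0 : 0 < h * h.
    rewrite -expr2 exprn_even_gt0//=; apply: contraTneq gh => ->.
    by rewrite mulr0 ltxx.
  have K : b * (f * h) = a * (g * h) - d * (h * h).
    transitivity (h * (a * g) - d * (h * h)); last by ring.
    by rewrite Ex; ring.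
  rewrite -(pmulr_rlt0 _ b0) K; nra.
- apply/seteqP; split => // x; have := E x; rewrite /sep /setI /=.
  set f := dotp x u; set g := dotp x w; set h := dotp x z.
  move: a0 d0 b0; set a := sin _; set d := sin _; set b := sin _ => a0 d0 b0 Ex [fg gh].
  have K : a * (g * g) = b * (f * g) + d * (g * h).
    by transitivity (g * (a * g)); [ring|rewrite Ex; ring].
  have : 0 <= a * (g * g) by rewrite mulr_ge0// -expr2 sqr_ge0.
  by rewrite K; nra.
Qed.

(** The mean value theorem for sin, whose derivative decreases. *)
Lemma mulr_cos_le_sin (t : R) : 0 <= t <= pi -> t * cos t <= sin t.
Proof.
move=> /andP[t0 tpi].
have [c ct E] := @MVT_segment R sin cos 0 t t0
  (fun s _ => is_derive_sin s) (@continuous_subspaceT _ _ _ _ (@continuous_sin R)).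
move: ct; rewrite in_itv/= => /andP[c0 ct].
move: E; rewrite sin0 !subr0 => ->; rewrite mulrC ler_wpM2r//.
rewrite le_eqVlt; have [->|ct'] := eqVneq c t; first by rewrite eqxx.
by rewrite ltr_cos ?in_itv/= ?c0 ?t0 ?(le_trans ct)// lt_neqAle ct' ct orbT.
Qed.

(** The exact probability is t / pi, with t the angle of u and v; an upper bound
    that is asymptotically sharp for close vectors is enough, and superadditivity
    gives one.  If k is the integral part of pi / t, then k p <= 1 because k steps
    of angle t stay in half a great circle.  Hence (pi - t) p <= t, and the angle
    is compared with the chord d by t cos t <= sin t <= d. *)
Lemma prob_sep_bound u v : enorm u = 1 -> enorm v = 1 -> enorm (u - v) <= 1 ->
  pi * prob (sep u v) * (1 - enorm (u - v)) ^+ 2 <= enorm (u - v).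
Proof.
move=> u1 v1; set d := enorm (u - v) => d1.
have d0 : 0 <= d by exact: enorm_ge0.
have dd : d ^+ 2 = 2 - 2 * dotp u v.
  rewrite enorm_sqr !(dotpDl, dotpDr, dotpNl, dotpNr) -!enorm_sqr u1 v1.
  by rewrite (dotpC v u); ring.
have [dz|dn0] := eqVneq d 0.
  have -> : v = u by apply/eqP; rewrite eq_sym -subr_eq0 -enorm_eq0 -/d dz.
  rewrite (_ : sep u u = set0) ?/prob ?measure0 ?mulr0 ?mul0r//.
  by apply/seteqP; split => // x; rewrite /sep/= -expr2 ltNge sqr_ge0.
have dp : 0 < d by rewrite lt_neqAle eq_sym dn0.
set c := dotp u v in dd *.
have c1 : c < 1 by nra.
have c0 : 0 < c by nra.
pose t := acos c.
have tc : cos t = c by apply: acosK; rewrite in_itv/=; lra.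
have t0 : 0 < t by apply: acos_gt0; lra.
have tpi : t <= pi by apply: acos_lepi; lra.
have std : sin t <= d.
  rewrite /t sin_acos; last lra.
  rewrite -(ger0_norm d0) -sqrtr_sqr ler_wsqrtr// dd; nra.
have tcd : t * c <= d.
  by apply: le_trans std; rewrite -tc; apply: mulr_cos_le_sin; rewrite tpi ltW.
set p := prob _.
have p0 : 0 <= p by exact: prob_ge0.
have p1 : p <= 1 by apply: prob_le1; exact: measurable_sep.
have pi2 := pi_ge2 R.
(* k p <= 1 and (k + 1) t > pi, where k = truncn (pi / t). *)
have pt : (pi - t) * p <= t.
  have pt0 : 0 <= pi / t by rewrite divr_ge0 ?pi_ge0// ltW.
  have /andP[] := truncn_itv pt0; set k := Num.truncn _ => k1 k2.
  have {}k2 : pi < k.+1%:R * t by rewrite -ltr_pdivrMr.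
  have {}k1 : k%:R * t <= pi by rewrite -ler_pdivlMr.
  have kp : k%:R * p <= 1.
    case: k k1 {k2} => [|k] k1; first by rewrite mul0r.
    apply: le_trans (prob_sep_le u1 v1 _ t0 k1) _; first by rewrite tc.
    by apply: prob_le1; exact: measurable_sep.
  rewrite -natr1 in k2; nra.
have H : c * ((pi - t) * p) <= c * t by rewrite ler_pM2l.
have cE : c = 1 - d ^+ 2 / 2 by rewrite dd; field.
(* It remains to compare c pi - d = (1 - d^2 / 2) pi - d with pi (1 - d)^2. *)
have H2 : p * (c * pi - d) <= d by nra.
apply: le_trans H2.
rewrite -mulrA mulrC -mulrA ler_wpM2l// cE.
have q : 0 <= pi * 2 - pi * d * (3 / 2) - 1 :> R by nra.
have := mulr_ge0 d0 q; nra.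
Qed.

End Separation.

(** * The tangent indicatrix of a regular arc *)

Lemma ler_subBB (R : realDomainType) (a b c d : R) :
  0 <= a - b - (c - d) -> b - d <= a - c.
Proof. lra. Qed.

Section Curve.
Variables (R : realType) (n : nat).
Implicit Types (u v g : R -> 'rV[R]_n) (t : R).

Lemma is_derive_coord u t i : derivable u t 1 ->
  is_derive t 1 (fun s => u s 0 i) (derive1 u t 0 i).
Proof.
move=> du; have di : derivable (fun s => u s 0 i) t 1 by have/derivable_mxP := du; apply.
apply: is_derive_eq; first exact: derivableP.
by rewrite derive1E derive_mx// mxE.
Qed.

Lemma is_derive_dotp u v t : derivable u t 1 -> derivable v t 1 ->
  is_derive t 1 (fun s => dotp (u s) (v s))
    (dotp (u t) (derive1 v t) + dotp (v t) (derive1 u t)).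
Proof.
move=> du dv.
have H : is_derive t 1 (\sum_(i < n) ((fun s => u s 0 i) * (fun s => v s 0 i)))
  (\sum_(i < n) (u t 0 i *: derive1 v t 0 i + v t 0 i *: derive1 u t 0 i)).
  by apply: is_derive_sum => i; apply: is_deriveM; exact: is_derive_coord.
rewrite big_split/= in H.
by rewrite (_ : (fun s => _) = \sum_(i < n) ((fun s => u s 0 i) * (fun s => v s 0 i)))//;
  apply/funext => s; rewrite fct_sumE.
Qed.

Definition speed g t := enorm (derive1 g t).

(** The derivative of the unit tangent, from the quotient rule.  It is continuous
    wherever the speed does not vanish. *)
Definition tangent' g t : 'rV[R]_n :=
  (speed g t)^-1 *: derive1 (derive1 g) t -
  (dotp (derive1 g t) (derive1 (derive1 g) t) / speed g t ^+ 3) *: derive1 g t.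

Variable g : R -> 'rV[R]_n.
Hypothesis C2g : regular_C2 g.

Let dg1 t : derivable (derive1 g) t 1. Proof. by case: C2g. Qed.

Let g1_neq0 t : 0 <= t <= 1 -> derive1 g t != 0.
Proof. by case: C2g => _ _ _; apply. Qed.

Let speed_gt0 t : 0 <= t <= 1 -> 0 < speed g t.
Proof. by move=> t01; rewrite enorm_gt0 g1_neq0. Qed.

Lemma is_derive_speed t : 0 <= t <= 1 -> is_derive t 1 (speed g)
  (dotp (derive1 g t) (derive1 (derive1 g) t) / speed g t).
Proof.
move=> t01; have n0 := speed_gt0 t01.
have H := is_derive_dotp (@dg1 t) (@dg1 t).
have p0 : 0 < dotp (derive1 g t) (derive1 g t).
  by rewrite -enorm_sqr exprn_gt0.
apply: is_derive_eq; first exact: (is_derive1_comp (is_derive1_sqrt p0) H).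
rewrite -/(enorm (derive1 g t)) -/(speed g t).
by field; rewrite gt_eqF.
Qed.

Lemma is_derive_tangent_coord t i : 0 <= t <= 1 ->
  is_derive t 1 (fun s => unit_tangent g s 0 i) (tangent' g t 0 i).
Proof.
move=> t01; have n0 := speed_gt0 t01.
have n1 : speed g t != 0 by rewrite gt_eqF.
have dV := is_deriveV n1 (is_derive_speed t01).
have := is_deriveM dV (is_derive_coord i (@dg1 t)).
rewrite (_ : _ * _ = fun s => unit_tangent g s 0 i); last first.
  by apply/funext => s; rewrite /unit_tangent /normalize mxE.
move/is_derive_eq; apply.
by rewrite /tangent' !mxE /GRing.scale/=; field.
Qed.

Lemma derivable_tangent t : 0 <= t <= 1 -> derivable (unit_tangent g) t 1.
Proof.
move=> t01; apply/derivable_mxP => i j; rewrite (ord1 i).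
by have [] := is_derive_tangent_coord j t01.
Qed.

Lemma derive1_tangent t : 0 <= t <= 1 ->
  derive1 (unit_tangent g) t = tangent' g t.
Proof.
move=> t01; rewrite derive1E derive_mx; last exact: derivable_tangent.
apply/matrixP => i j; rewrite mxE (ord1 i).
by have [_] := is_derive_tangent_coord j t01.
Qed.

Lemma continuous_tangent' t : 0 <= t <= 1 ->
  {for t, continuous (fun s => enorm (tangent' g s))}.
Proof.
move=> t01; have n0 := speed_gt0 t01.
have n1 : speed g t != 0 by rewrite gt_eqF.
have c1 i : {for t, continuous (fun s => derive1 g s 0 i)}.
  by apply: differentiable_continuous; apply/derivable1_diffP;
    have [] := is_derive_coord i (@dg1 t).
have c2 i : {for t, continuous (fun s => derive1 (derive1 g) s 0 i)}.
  have [_ _ c _] := C2g.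
  apply: (@continuous_comp _ _ _ _ (fun x : 'rV[R]_n => x 0 i)); first exact: c.
  exact: coord_continuous.
have cs : {for t, continuous (speed g)}.
  by apply: differentiable_continuous; apply/derivable1_diffP;
    have [] := is_derive_speed t01.
have cd u v : (forall i, {for t, continuous (fun s => u s 0 i)}) ->
    (forall i, {for t, continuous (fun s => v s 0 i)}) ->
    {for t, continuous (fun s => dotp (u s) (v s))}.
  move=> cu cv; rewrite /dotp; elim: (index_enum _) => [|i r IH].
    have -> : (fun s => \sum_(i <- [::]) u s 0 i * v s 0 i) = cst 0.
      by apply/funext => s; rewrite big_nil.
    exact: cst_continuous.
  have -> : (fun s => \sum_(i <- i :: r) u s 0 i * v s 0 i) =
      (fun s => u s 0 i * v s 0 i + \sum_(i <- r) u s 0 i * v s 0 i).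
    by apply/funext => s; rewrite big_cons.
  by apply: continuousD => //; apply: continuousM.
apply: (@continuous_comp _ _ _ _ (@Num.sqrt R)); last exact: sqrt_continuous.
have ct i : {for t, continuous (fun s => tangent' g s 0 i)}.
  rewrite (_ : (fun s => _) = (fun s => (speed g s)^-1 * derive1 (derive1 g) s 0 i -
    dotp (derive1 g s) (derive1 (derive1 g) s) * (speed g s ^+ 3)^-1
      * derive1 g s 0 i)); last by apply/funext => s; rewrite !mxE.
  apply: continuousB.
    by apply: continuousM => //; apply: continuousV.
  apply: continuousM; last exact: c1.
  have cdd := cd _ _ c1 c2.
  apply: continuousM; first exact: cdd.
  apply: continuousV; first by rewrite expf_neq0.
  apply: (@continuous_comp _ _ _ _ (fun x : R => x ^+ 3)) => //.
  exact: exprn_continuous.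
exact: cd.
Qed.

Notation leb := (@lebesgue_measure R).
Let q s := enorm (tangent' g s).
Let L x : R := (\int[leb]_(y in `[0, x]) q y)%R.

Let cq : {within `[0, 1], continuous q}.
Proof.
apply: continuous_in_subspaceT => t; rewrite inE/= in_itv/= => t01.
exact: continuous_tangent'.
Qed.

Let iq : leb.-integrable `[0%R, 1%R] (EFin \o q).
Proof. by apply: continuous_compact_integrable => //; exact: segment_compact. Qed.

Lemma total_curvatureE : total_curvature g = (L 1 - L 0)%:E.
Proof.
have -> : L 0 = 0 by rewrite /L set_itv1 Rintegral_set1.
rewrite subr0 /L /Rintegral fineK; last exact: integrable_fin_num.
rewrite -integral_itv_bndo_bndc; last first.
  apply/measurable_funS : (measurable_int leb iq) => //.
  by apply: subset_itvl; rewrite bnd_simp.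
rewrite -integral_itv_obnd_cbnd; last first.
  apply/measurable_funS : (measurable_int leb iq) => //.
  by apply: subset_itv; rewrite bnd_simp.
apply: eq_integral => t; rewrite inE/= in_itv/= => /andP[t0 t1].
have t01 : 0 <= t <= 1 by rewrite !ltW.
have n0 := speed_gt0 t01.
congr EFin; rewrite /curvature derive1_tangent// enormZ ?invr_ge0 ?enorm_ge0//.
by rewrite mulrC mulVKf// gt_eqF.
Qed.

Let is_derive_L t : 0 < t < 1 -> is_derive t 1 L (q t).
Proof.
move=> /andP[t0 t1].
have t01 : 0 <= t <= 1 by rewrite !ltW.
have [dL L'] := continuous_FTC1_closed t1 iq t0 (continuous_tangent' t01).
by apply: is_derive_eq; [exact: derivableP|rewrite -derive1E].
Qed.

Let cL : {within `[0, 1], continuous L}.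
Proof. exact: parameterized_integral_continuous. Qed.

Let sub01 s t : 0 <= s -> t <= 1 -> `[s, t] `<=` `[0%R, 1%R].
Proof. by move=> s0 t1; apply: subset_itv; rewrite bnd_simp. Qed.

(** The chord of the tangent indicatrix is at most its length: for a vector z of
    norm at most 1, the function L - dotp z T is nondecreasing, because its
    derivative is q - dotp z T' >= 0; then take for z the direction of the
    chord. *)
Lemma enorm_tangent_sub_le s t : 0 <= s -> s <= t -> t <= 1 ->
  enorm (unit_tangent g t - unit_tangent g s) <= L t - L s.
Proof.
move=> s0 st t1; set v := _ - _.
have dT (z : 'rV[R]_n) (x : R) : 0 <= x <= 1 ->
    is_derive x 1 (fun x => dotp z (unit_tangent g x)) (dotp z (tangent' g x)).
  move=> x01; have dz : derivable (fun _ : R => z) x 1 by exact: derivable_cst.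
  apply: is_derive_eq; first exact: is_derive_dotp (derivable_tangent x01).
  by rewrite derive1_cst dotpC (dotpC _ 0) !dotp0l addr0 derive1_tangent// dotpC.
(* The case z = 0 gives the inequality when the chord vanishes. *)
have H (z : 'rV[R]_n) : (forall w, dotp z w <= enorm w) -> dotp z v <= L t - L s.
  move=> zw.
  pose h (x : R) := L x - dotp z (unit_tangent g x).
  have dh x : x \in `]s, t[ -> is_derive x 1 h (q x - dotp z (tangent' g x)).
    rewrite in_itv/= => /andP[sx xt]; apply: is_deriveB.
      by apply: is_derive_L; rewrite (le_lt_trans s0)//= (lt_le_trans xt).
    by apply: dT; rewrite (le_trans s0 (ltW sx)) (le_trans (ltW xt)).
  have ch : {within `[s, t], continuous h}.
    apply: (@continuous_subspaceW _ _ `[s, t]%classic `[0%R, 1%R]%classic); first exact: sub01.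
    move=> x; apply: continuousB; first exact: cL.
    apply: continuous_in_subspaceT => y; rewrite inE/= in_itv/= => y01.
    apply: differentiable_continuous; apply/derivable1_diffP.
    by have [] := dT z y y01.
  have [c ct E] := MVT_segment st dh ch.
  have : 0 <= (q c - dotp z (tangent' g c)) * (t - s).
    by rewrite mulr_ge0 ?subr_ge0// zw.
  by rewrite -E /h /v dotpDr dotpNr; exact: ler_subBB.
have [v0|v0] := eqVneq v 0.
  have := H 0; rewrite dotp0l v0 => H0.
  have -> : enorm (0 : 'rV[R]_n) = 0 by apply/eqP; rewrite enorm_eq0.
  by apply: H0 => w; rewrite dotp0l enorm_ge0.
have := H _ (fun w => dotp_le_enorm w (enorm_normalize v0)).
by rewrite /normalize dotpZl -enorm_sqr expr2 mulKf// enorm_eq0.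
Qed.

(** All that is needed of an arc in the sequel: the length function F of its
    tangent indicatrix dominates chords, is Lipschitz, and its total variation is
    the total curvature. *)
Lemma curvature_primitive_lipschitz : exists K, 0 <= K /\
  forall s t, 0 <= s -> s <= t -> t <= 1 -> L t - L s <= K * (t - s).
Proof.
have [c c01 qc] := @EVT_max R q 0 1 ler01 cq.
exists (q c); split; first exact: enorm_ge0.
move=> s t s0 st t1.
have dL x : x \in `]s, t[ -> is_derive x 1 L (q x).
  rewrite in_itv/= => /andP[sx xt]; apply: is_derive_L.
  by rewrite (le_lt_trans s0)//= (lt_le_trans xt).
have cL' : {within `[s, t], continuous L}.
  by apply: (@continuous_subspaceW _ _ `[s, t]%classic `[0%R, 1%R]%classic); [exact: sub01|exact: cL].
have [x xt ->] := MVT_segment st dL cL'.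
have qxc : q x <= q c.
  apply: qc; move: xt; rewrite !in_itv/= => /andP[sx xt].
  by rewrite (le_trans s0 sx) (le_trans xt).
have ts0 : 0 <= t - s by rewrite subr_ge0.
by move: (q x) (q c) (t - s) qxc ts0 => a b d ab d0; rewrite ler_wpM2r.
Qed.

Lemma curvature_primitive : exists (F : R -> R) (K : R),
  [/\ 0 <= K, total_curvature g = (F 1 - F 0)%:E &
   forall s t, 0 <= s -> s <= t -> t <= 1 ->
     enorm (unit_tangent g t - unit_tangent g s) <= F t - F s <= K * (t - s)].
Proof.
have [K [K0 HK]] := curvature_primitive_lipschitz.
exists L, K; split => //; first exact: total_curvatureE.
by move=> s t s0 st t1; rewrite enorm_tangent_sub_le ?HK.
Qed.

End Curve.

(** * A Crofton inequality for total curvature *)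

Section Turn.
Variables (R : realType) (n : nat).
Implicit Types (u v x : 'rV[R]_n).

(** The height function of direction x increases along u and decreases along v. *)
Definition turn u v := [set x : 'rV[R]_n | 0 < dotp x u /\ dotp x v < 0].

Lemma measurable_turn u v : measurable (turn u v).
Proof.
rewrite (_ : turn u v = (fun x => dotp x u) @^-1` `]0, +oo[ `&`
                        (fun x => dotp x v) @^-1` `]-oo, 0[).
  by apply: measurableI; rewrite -[X in measurable X]setTI;
    exact: measurable_dotp.
by apply/seteqP; split => x; rewrite /turn/= !in_itv/= andbT.
Qed.

(** The antipodal map exchanges the two ways of being separated. *)
Lemma prob_turn u v : prob (sep u v) = 2 * prob (turn u v).
Proof.
have NN : - 1%:M *m (- 1%:M)^T = 1%:M :> 'M[R]_n.
  by rewrite linearN/= trmx1 mulNmx mul1mx opprK.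
have mN : measurable [set x | turn u v (x *m (- 1%:M))].
  rewrite -[X in measurable X]setTI.
  by apply: measurable_mulmxr => //; exact: measurable_turn.
have NE x : x *m (- 1%:M) = - x by rewrite mulmxN mulmx1.
have -> : sep u v = turn u v `|` [set x | turn u v (x *m (- 1%:M))].
  apply/seteqP; split => x; rewrite /sep /turn /setU/= NE !dotpNl.
    by move=> H; have [h|h|h] := ltgtP (dotp x u) 0; [right|left|]; nra.
  by nra.
rewrite prob_disjU ?(prob_orth NN) ?mulr2n ?mulrDl ?mul1r//.
- exact: measurable_turn.
- exact: measurable_turn.
by apply/seteqP; split => // x; rewrite /turn /setI/= NE !dotpNl; nra.
Qed.

Lemma dotp_cauchy u v : `|dotp u v| <= enorm u * enorm v.
Proof.
have H w : dotp w v <= enorm w * enorm v.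
  have [->|w0] := eqVneq w 0.
    by rewrite dotp0l mulr_ge0// enorm_ge0.
  have := dotp_le_enorm v (enorm_normalize w0).
  rewrite /normalize dotpZl mulrC ler_pdivrMr ?enorm_gt0//.
  by rewrite [enorm v * _]mulrC.
by rewrite ler_norml H andbT lerNl -dotpNl -[enorm u]enormN; exact: H.
Qed.

End Turn.

Lemma opposite_signs_near (R : realDomainType) (a b c d e : R) :
  e <= a -> e <= - b -> `|a - c| < e -> `|b - d| < e -> 0 < c /\ d < 0.
Proof. by rewrite !ltr_norml => ? ? /andP[? ?] /andP[? ?]; split; lra. Qed.

Section Crofton.
Variables (R : realType) (n : nat) (g : R -> 'rV[R]_n).
Hypothesis C2g : regular_C2 g.
Notation T := (unit_tangent g).

Definition dyadic (M i : nat) : R := i%:R / 2 ^+ M.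

Let pow0 M : (0 : R) < 2 ^+ M. Proof. by rewrite exprn_gt0. Qed.

Let dyadic_ge0 M i : 0 <= dyadic M i.
Proof. by rewrite divr_ge0// ltW. Qed.

Let dyadic_le1 M i : (i <= 2 ^ M)%N -> dyadic M i <= 1.
Proof. by move=> iM; rewrite ler_pdivrMr// mul1r -natrX ler_nat. Qed.

Let dyadic_le M i j : (i <= j)%N -> dyadic M i <= dyadic M j.
Proof. by move=> ij; rewrite ler_pM2r ?invr_gt0// ler_nat. Qed.

Let dyadicS M i : dyadic M i.+1 - dyadic M i = (2 ^+ M)^-1.
Proof. by rewrite /dyadic -mulrBl -natr1 addrC addKr mul1r. Qed.

Let tangent_unit t : 0 <= t <= 1 -> enorm (T t) = 1.
Proof. by move=> t01; apply: enorm_normalize; case: C2g => _ _ _; apply. Qed.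

(** The directions whose height function is seen to go up and later down from its
    slopes at the dyadic times of level M. *)
Definition dyadic_turns M : set 'rV[R]_n :=
  \bigcup_(i in [set i | (i <= 2 ^ M)%N])
    \bigcup_(j in [set j | (i <= j <= 2 ^ M)%N])
      turn (T (dyadic M i)) (T (dyadic M j)).

Lemma measurable_dyadic_turns M : measurable (dyadic_turns M).
Proof.
apply: bigcup_measurable => i _; apply: bigcup_measurable => j _.
exact: measurable_turn.
Qed.

Lemma dyadic_turns_nondecreasing : nondecreasing_seq dyadic_turns.
Proof.
apply/nondecreasing_seqP => M; apply/subsetPset => x [i /= iM [j /= ijM xij]].
have E k : dyadic M.+1 k.*2 = dyadic M k.
  by rewrite /dyadic -muln2 natrM exprS invfM mulrA mulfK//.
exists i.*2; first by rewrite /= expnS mul2n leq_double.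
exists j.*2; last by rewrite !E.
by rewrite /= expnS mul2n !leq_double.
Qed.

Lemma sign_change (f : nat -> R) (i j : nat) : (i <= j)%N ->
  0 < f i -> f j <= 0 -> exists k, [/\ (k < j)%N, 0 < f k & f k.+1 <= 0].
Proof.
elim: j => [|j IH].
  by rewrite leqn0 => /eqP -> fi /(lt_le_trans fi); rewrite ltxx.
rewrite leq_eqVlt => /orP[/eqP -> fi /(lt_le_trans fi)|ij fi fj].
  by rewrite ltxx.
have [fj0|fj0] := ltP 0 (f j); first by exists j.
by have [k [kj fk fk1]] := IH ij fi fj0; exists k; rewrite ltnS ltnW.
Qed.

(** A direction that goes up and later down along the dyadic times does so at two
    consecutive ones, unless a slope vanishes, which has probability 0. *)
Lemma prob_dyadic_turns_le M :
  prob (dyadic_turns M) <=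
  \sum_(i < 2 ^ M) prob (turn (T (dyadic M i)) (T (dyadic M i.+1))).
Proof.
pose D i := turn (T (dyadic M i)) (T (dyadic M i.+1)).
pose Z i := [set x : 'rV[R]_n | dotp x (T (dyadic M i)) = 0].
have mD i : measurable (D i) by exact: measurable_turn.
have mZ i : measurable (Z i) by exact: measurable_hyperplane.
have sub : dyadic_turns M `<=`
    \big[setU/set0]_(i < 2 ^ M) (D i `|` Z i.+1).
  move=> x [i /= iM [j /= /andP[ij jM] [xi xj]]].
  have [k [kj xk xk1]] := sign_change (f := fun i => dotp x (T (dyadic M i)))
    ij xi (ltW xj).
  rewrite -(bigcup_mkord _ (fun i => D i `|` Z i.+1)); exists k; first by rewrite /= (leq_trans kj).
  have [xk0|xk0] := eqVneq (dotp x (T (dyadic M k.+1))) 0; first by right.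
  by left; split; [exact: xk|rewrite lt_neqAle xk0 xk1].
rewrite -lee_fin probE; last exact: measurable_dyadic_turns.
have mDZ i : (i < 2 ^ M)%N -> measurable (D i `|` Z i.+1).
  by move=> _; exact: measurableU.
apply: le_trans (content_subadditive (@direction_law R n) mDZ
  (measurable_dyadic_turns M) sub) _.
rewrite -sumEFin; apply: lee_sum => i _.
apply: le_trans (measureU2 _ _ _) _ => //.
have T0 : T (dyadic M i.+1) != 0.
  by rewrite -enorm_eq0 tangent_unit ?oner_eq0// dyadic_ge0 dyadic_le1.
have Z0 : direction_law (Z i.+1) = 0%E by exact: direction_law_hyperplane.
rewrite [X in (_ + X)%E]Z0 adde0 probE; first exact: lexx.
exact: measurable_turn.
Qed.

(** In a random direction the expected number of interior local extrema of the
    height function is at most the total curvature divided by pi.  This is the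
    part of it used below: S contains the directions in which the height goes up
    and later down, so has a local maximum, and by symmetry maxima and minima have
    the same expectation; hence the factor 2.

    S is the increasing union of the events of the dyadic levels.  At level M, the
    probability is at most half the sum of the separation probabilities of
    consecutive tangents.  By prob_sep_bound, these are at most the distances of
    the tangents divided by pi, up to a factor tending to 1, and the sum of the
    distances is at most the length of the indicatrix. *)
Theorem crofton : exists S : set 'rV[R]_n,
  [/\ measurable S,
   forall x s t, 0 <= s -> s <= t -> t <= 1 ->
     0 < dotp x (T s) -> dotp x (T t) < 0 -> S x &
   ((2 * pi * prob S)%:E <= total_curvature g)%E].
Proof.
have [F [K [K0 -> FK]]] := curvature_primitive C2g.
have mS : measurable (\bigcup_M dyadic_turns M).
  by apply: bigcupT_measurable => M; exact: measurable_dyadic_turns.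
exists (\bigcup_M dyadic_turns M); split => //.
  move=> x s t s0 st t1 xs xt.
  have t0 : 0 <= t by exact: le_trans st.
  have s1 : s <= 1 by exact: le_trans t1.
  (* Both slopes keep their signs under perturbations smaller than e; the level M
     makes the dyadic approximation of the tangents finer than that. *)
  pose e := Num.min (dotp x (T s)) (- dotp x (T t)).
  have e0 : 0 < e by rewrite lt_min xs oppr_gt0.
  pose M := Num.truncn (enorm x * K / e).
  have HM : enorm x * (K / 2 ^+ M) < e.
    have : enorm x * K / e < M.+1%:R by exact: truncnS_gt.
    rewrite ltr_pdivrMr// => H; rewrite mulrA ltr_pdivrMr//.
    apply: lt_le_trans H _; rewrite mulrC ler_pM2l// -natrX ler_nat.
    exact: ltn_expl.
  have near r : 0 <= r <= 1 -> let i := Num.truncn (r * 2 ^+ M) in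
      (i <= 2 ^ M)%N /\ `|dotp x (T r) - dotp x (T (dyadic M i))| < e.
    move=> /andP[r0 r1] i.
    have rM : 0 <= r * 2 ^+ M by rewrite mulr_ge0// ltW.
    have /andP[i1 i2] := truncn_itv rM; rewrite -/i in i1 i2.
    have iM : (i <= 2 ^ M)%N.
      rewrite -(ler_nat R) natrX; apply: le_trans i1 _.
      by rewrite ler_piMl// ltW.
    split => //; rewrite -dotpNr -dotpDr.
    apply: le_lt_trans (dotp_cauchy _ _) _; apply: le_lt_trans HM.
    apply: ler_wpM2l; first exact: enorm_ge0.
    have di : dyadic M i <= r by rewrite ler_pdivrMr.
    have /andP[H1 H2] := FK _ _ (dyadic_ge0 M i) di r1.
    apply: le_trans H1 _; apply: le_trans H2 _; apply: ler_wpM2l => //.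
    rewrite -(dyadicS M i) lerD2r ler_pdivlMr//; exact: ltW.
  have s01 : 0 <= s <= 1 by rewrite s0.
  have t01 : 0 <= t <= 1 by rewrite t0.
  have [iM Hi] := near s s01; have [jM Hj] := near t t01.
  exists M => //; exists (Num.truncn (s * 2 ^+ M)) => //.
  exists (Num.truncn (t * 2 ^+ M)).
    by rewrite /= jM andbT le_truncn// ler_wpM2r// ltW.
  have es : e <= dotp x (T s) by rewrite ge_min lexx.
  have et : e <= - dotp x (T t) by rewrite ge_min lexx orbT.
  exact: opposite_signs_near es et Hi Hj.
set k := F 1 - F 0.
have pi0 : 0 <= 2 * pi :> R by rewrite mulr_ge0// pi_ge0.
have pi0' : 0 < 2 * pi :> R by rewrite mulr_gt0// pi_gt0.
(* At level M all chords are at most d = K / 2 ^ M, which makes the error factor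
   of prob_sep_bound uniform. *)
have step M : K / 2 ^+ M <= 1 ->
    2 * pi * prob (dyadic_turns M) * (1 - K / 2 ^+ M) ^+ 2 <= k.
  set d := K / 2 ^+ M => d1.
  have d0 : 0 <= d by rewrite divr_ge0// ltW.
  apply: (@le_trans _ _ (\sum_(i < 2 ^ M)
    2 * pi * prob (turn (T (dyadic M i)) (T (dyadic M i.+1))) * (1 - d) ^+ 2)).
    rewrite -mulr_suml -mulr_sumr ler_wpM2r ?sqr_ge0//.
    by apply: ler_wpM2l; [exact: pi0|exact: prob_dyadic_turns_le].
  apply: (@le_trans _ _ (\sum_(i < 2 ^ M) (F (dyadic M i.+1) - F (dyadic M i)))).
    apply: ler_sum => i _.
    have ii : dyadic M i <= dyadic M i.+1 by exact: dyadic_le.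
    have i0 := dyadic_ge0 M i; have i1 : dyadic M i.+1 <= 1 by exact: dyadic_le1.
    have /andP[H1 H2] := FK _ _ i0 ii i1.
    have Hd : F (dyadic M i.+1) - F (dyadic M i) <= d.
      by rewrite /d -(dyadicS M i).
    rewrite -enormN opprB in H1; apply: (le_trans _ H1).
    set u := T (dyadic M i) in H1 *; set v := T (dyadic M i.+1) in H1 *.
    have u1 : enorm u = 1 by apply: tangent_unit; rewrite i0 (le_trans ii).
    have v1 : enorm v = 1 by apply: tangent_unit; rewrite i1 (le_trans i0).
    have uvd : enorm (u - v) <= d by exact: le_trans Hd.
    have := prob_sep_bound u1 v1 (le_trans uvd d1).
    rewrite prob_turn mulrA [pi * 2]mulrC; apply: le_trans.
    apply: ler_wpM2l; first by rewrite mulr_ge0// prob_ge0.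
    have uv0 := enorm_ge0 (u - v).
    by rewrite ler_sqr ?nnegrE ?subr_ge0 ?(le_trans uvd)// lerD2l lerN2.
  rewrite -(big_mkord xpredT (fun i => F (dyadic M i.+1) - F (dyadic M i))).
  rewrite telescope_sumr//.
  by rewrite /dyadic mul0r natrX divff ?gt_eqF.
(* The probabilities increase with the level, while the error factor tends to
   1; so the inequality holds without it. *)
have bound M : 2 * pi * prob (dyadic_turns M) <= k.
  set p := 2 * pi * prob _.
  have p0 : 0 <= p by rewrite mulr_ge0// prob_ge0.
  have H e : 0 < e -> e <= 1 -> p * (1 - e) ^+ 2 <= k.
    move=> e0 e1; pose m := Num.truncn (K / e).
    have Hm : K / 2 ^+ (maxn M m) <= e.
      rewrite ler_pdivrMr// mulrC -ler_pdivrMr//.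
      apply: (@le_trans _ _ m.+1%:R); first exact/ltW/truncnS_gt.
      rewrite -natrX ler_nat; apply: leq_trans (ltn_expl m (ltnSn 1)) _.
      by rewrite leq_exp2l// leq_maxr.
    apply: le_trans (step (maxn M m) (le_trans Hm e1)).
    have Hp : p <= 2 * pi * prob (dyadic_turns (maxn M m)).
      apply: ler_wpM2l; first exact: pi0.
      apply: prob_sub; [exact: measurable_dyadic_turns..|].
      by apply/subsetPset; apply: dyadic_turns_nondecreasing; exact: leq_maxl.
    have Hs : (1 - e) ^+ 2 <= (1 - K / 2 ^+ maxn M m) ^+ 2.
      by rewrite ler_sqr ?nnegrE ?subr_ge0 ?(le_trans Hm e1)// lerD2l lerN2.
    exact: ler_pM p0 (sqr_ge0 _) Hp Hs.
  rewrite leNgt; apply/negP => kp.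
  have p1 : 0 < p + 1 by lra.
  pose e := Num.min 1 ((p - k) / (4 * (p + 1))).
  have e0 : 0 < e by rewrite lt_min ltr01 divr_gt0// ?subr_gt0// mulr_gt0.
  have e1 : e <= 1 by rewrite ge_min lexx.
  have e2 : e * (4 * (p + 1)) <= p - k.
    by rewrite -ler_pdivlMr ?mulr_gt0// ge_min lexx orbT.
  have := H e e0 e1; nra.
have cv := nondecreasing_cvg_mu (mu := @direction_law R n)
  measurable_dyadic_turns mS dyadic_turns_nondecreasing.
have : (direction_law (\bigcup_M dyadic_turns M) <= (k / (2 * pi))%:E)%E.
  move/cvg_lim : (cv) => <-//; apply: lime_le; first by apply/cvg_ex; eexists; exact: cv.
  near=> M; rewrite /= -probE; last exact: measurable_dyadic_turns.
  by rewrite lee_fin ler_pdivlMr// mulrC.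
rewrite -probE// lee_fin ler_pdivlMr// => H.
by rewrite lee_fin mulrC.
Unshelve. all: by end_near. Qed.

End Crofton.

(** * Crossing edges and local maxima *)

Section Cut.
Variables (R : realDomainType) (G : graph).

Definition crossing (S : pred (vertex G)) (a : edge G) : bool :=
  S (src a) != S (tgt a).

(** S is a set of the form {h > c}, up to a choice among the vertices at height
    c.  The choice is needed because vertices may have the same image. *)
Definition upper (h : vertex G -> R) (S : pred (vertex G)) : Prop :=
  forall q q', S q -> ~~ S q' -> h q' <= h q.

(** The excess of a vertex is the number of its edge-ends that go down minus the
    number of those that go up, counted when positive.  The positive parts
    dominate the sum over the vertices of S alone, and this sum is a sum over
    edges.  An edge with both ends in S, or none, contributes at least 0 once its
    possible interior maximum (p) is added, and an edge that enters S from below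
    contributes at least 1: either it arrives upwards, or it has gone up before
    and turned.  Here s0 and s1 are the signs of the slopes at the start and at
    the end of the edges. *)
Lemma crossing_le_max (h : vertex G -> R) (S : pred (vertex G))
    (s0 s1 : edge G -> R) (p : edge G -> bool) :
  upper h S ->
  (forall a, s0 a = 1 \/ s0 a = -1) -> (forall a, s1 a = 1 \/ s1 a = -1) ->
  (forall a, s0 a = 1 -> s1 a = -1 -> p a) ->
  (forall a, h (src a) <= h (tgt a) -> s1 a = -1 -> p a) ->
  (forall a, h (tgt a) <= h (src a) -> s0 a = 1 -> p a) ->
  \sum_(a : edge G) (crossing S a)%:R <=
  \sum_(q : vertex G) Num.max
    (\sum_(a : edge G | src a == q) - s0 a + \sum_(a : edge G | tgt a == q) s1 a) 0
  + \sum_(a : edge G) 2 * (p a)%:R.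
Proof.
move=> up s0E s1E H1 H2 H3.
pose chi q := \sum_(a : edge G | src a == q) - s0 a +
  \sum_(a : edge G | tgt a == q) s1 a.
apply: (@le_trans _ _ (\sum_(q | S q) chi q + \sum_a 2 * (p a)%:R)); last first.
  rewrite lerD2r [leRHS](bigID S)/= -[leLHS]addr0 lerD//.
    by apply: ler_sum => q _; rewrite le_max lexx.
  by apply: sumr_ge0 => q _; rewrite le_max lexx orbT.
rewrite /chi big_split/=.
have sumE (f : edge G -> vertex G) (x : edge G -> R) :
    \sum_(q | S q) \sum_(a | f a == q) x a = \sum_a (S (f a))%:R * x a.
  rewrite (exchange_big_dep xpredT)//=; apply: eq_bigr => a _.
  case: (boolP (S (f a))) => Sf.
    rewrite (big_pred1 (f a)) ?mul1r// => q /=; rewrite eq_sym.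
    by case: eqP => [-> | ]; rewrite ?Sf ?andbF.
  rewrite mul0r big1// => q /andP[Sq /eqP fq].
  by move: Sf; rewrite fq Sq.
rewrite !sumE -!big_split/=; apply: ler_sum => a _.
have h1 := H1 a; have h2 := H2 a; have h3 := H3 a.
rewrite /crossing; case: (boolP (S (src a))) => Ss; case: (boolP (S (tgt a))) => St /=.
- case: (s0E a) => E0; case: (s1E a) => E1; [| rewrite (h1 E0 E1) | |];
    rewrite E0 E1; case: (p a) => /=; lra.
- have hh := up _ _ Ss St; case: (s0E a) => E0; first by rewrite E0 h3//=; lra.
  by rewrite E0; case: (p a) => /=; lra.
- have hh := up _ _ St Ss; case: (s1E a) => E1; last by rewrite E1 h2//=; lra.
  by rewrite E1; case: (p a) => /=; lra.
- by case: (p a) => /=; lra.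
Qed.

End Cut.

Section Lift.
Variables (G : graph) (k : edge G -> nat) (S : pred (vertex (subdivision k))).

(** The side of the j-th vertex on the path that replaces the edge e, where j = 0
    is the source and j = k e + 1 the target. *)
Definition chain_side (e : edge G) (j : nat) : bool :=
  if j is j'.+1 then
    if (insub j' : option 'I_(k e)) is Some o then S (inr (Tagged (fun e => 'I_(k e)) o))
    else S (inl (tgt e))
  else S (inl (src e)).

Lemma chain_side_src (e : edge G) (i : 'I_(k e).+1) :
  S (@src (subdivision k) (Tagged (fun e => 'I_(k e).+1) i)) = chain_side e i.
Proof.
rewrite /=; case: unliftP => [j ->|->] //=.
by rewrite /bump/= add0n; case: insubP => [u _ /val_inj -> | ]; rewrite ?ltn_ord.
Qed.

Lemma chain_side_tgt (e : edge G) (i : 'I_(k e).+1) :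
  S (@tgt (subdivision k) (Tagged (fun e => 'I_(k e).+1) i)) = chain_side e i.+1.
Proof.
rewrite /=; case: unliftP => [j ->|->] /=.
  rewrite /bump leqNgt ltn_ord add0n.
  by case: insubP => [u _ /val_inj -> | ]; rewrite ?ltn_ord.
by rewrite insubN ?ltnn.
Qed.

Lemma chain_side_last (e : edge G) : chain_side e (k e).+1 = S (inl (tgt e)).
Proof. by rewrite /=; case: insubP => [u | ]; rewrite ?ltnn. Qed.

(** A path that joins the two sides of a cut has an edge that crosses it. *)
Lemma crossing_lift :
  (\sum_(e : edge G) (S (inl (src e)) != S (inl (tgt e))) <=
   \sum_(a : edge (subdivision k)) crossing S a)%N.
Proof.
have -> : (\sum_(a : edge (subdivision k)) crossing S a =
    \sum_(e : edge G) \sum_(i < (k e).+1)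
      crossing S (Tagged (fun e => 'I_(k e).+1) i : edge (subdivision k)))%N.
  rewrite sig_big_dep/=; apply: eq_bigr => -[e i] _ //=.
apply: leq_sum => e _.
under eq_bigr do rewrite /crossing chain_side_src chain_side_tgt.
rewrite -(chain_side_last e) -[S (inl (src e))]/(chain_side e 0).
elim: (k e).+1 => [|m IH]; first by rewrite eqxx.
rewrite big_ord_recr; apply: leq_trans (leq_add IH (leqnn _)).
move: (chain_side e 0) (chain_side e m) (chain_side e m.+1) => b0 bm bm1; by case: b0 bm bm1 => [] [] [].
Qed.

End Lift.

(** * Median cuts *)

Section Median.
Variables (R : realDomainType) (V : finType) (h : V -> R) (m n : nat).
Variable f : ('I_m + 'I_n)%type -> V.
Hypotheses (inj_f : injective f) (m0 : (0 < m)%N) (n0 : (0 < n)%N).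

Let s := sort (fun a b => h a <= h b) (enum V).

Let mem_s q : q \in s. Proof. by rewrite mem_sort mem_enum. Qed.

Let s_sorted : pairwise (fun a b => h a <= h b) s.
Proof.
rewrite -sorted_pairwise; last by move=> y x z; exact: le_trans.
by apply: sort_sorted => x y; exact: le_total.
Qed.

Let c k := (\sum_(i < m) (f (inl i) \in take k s))%N.
Let d k := (\sum_(j < n) (f (inr j) \in take k s))%N.

Let cd_step k : (c k.+1 + d k.+1 <= (c k + d k).+1)%N.
Proof.
have E l : (c l + d l = \sum_(e : 'I_m + 'I_n) (f e \in take l s))%N.
  by rewrite big_sumType.
rewrite !E; have [ks|ks] := ltnP k (size s); last first.
  by rewrite !take_oversize// (leq_trans ks).
have x0 : V := f (inl (Ordinal m0)).
rewrite (take_nth x0 ks).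
under eq_bigr do rewrite mem_rcons inE.
set x := nth _ _ _.
apply: (@leq_trans (\sum_e ((f e == x) + (f e \in take k s)))%N).
  by apply: leq_sum => e _; case: (f e == x); case: (f e \in _).
rewrite big_split/= -[X in (_ <= X)%N]add1n leq_add2r.
have [[e /eqP fe]|/forallNP nx] := pselect (exists e, f e == x).
  rewrite (bigD1 e)//= fe eqxx big1// => e' e'e.
  by rewrite -fe (inj_eq inj_f) (negPf e'e).
by rewrite big1// => e _; have /negP/negPf -> := nx e.
Qed.

Let c_mono k : (c k <= c k.+1)%N.
Proof.
apply: leq_sum => i _; case: (boolP (_ \in take k s)) => // H.
by move: H; rewrite -(take_takel _ (leqnSn k)) => /mem_take ->.
Qed.

Let d_mono k : (d k <= d k.+1)%N.
Proof.
apply: leq_sum => i _; case: (boolP (_ \in take k s)) => // H.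
by move: H; rewrite -(take_takel _ (leqnSn k)) => /mem_take ->.
Qed.

(** Sort all the points by height, and take the smallest initial segment that
    contains half of one of the two families: as it grows by one point at a time,
    it contains at most half of the other family. *)
Lemma median_cut : exists S : pred V,
  (forall q q', S q -> ~~ S q' -> h q' <= h q) /\
  let x := (\sum_(i < m) ~~ S (f (inl i)))%N in
  let y := (\sum_(j < n) ~~ S (f (inr j)))%N in
  ((m <= 2 * x) && (2 * y <= n) || (n <= 2 * y) && (2 * x <= m))%N.
Proof.
have ex : exists k, ((m <= 2 * c k) || (n <= 2 * d k))%N.
  exists (size s); rewrite /c take_size.
  by under eq_bigr do rewrite mem_s; rewrite sum1_card card_ord leq_pmull.
case: (ex_minnP ex) => k Hk kmin.
exists (fun q => q \notin take k s); split.
  move=> q q'; rewrite negbK => qk q'k.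
  have : q \in drop k s.
    by have := mem_s q; rewrite -{1}(cat_take_drop k s) mem_cat (negPf qk).
  move: s_sorted; rewrite -{1}(cat_take_drop k s) pairwise_cat.
  by move=> /and3P[/allrelP H _ _] /(H _ _ q'k).
move=> x y.
have {x}-> : x = c k by apply: eq_bigr => i _; rewrite negbK.
have {y}-> : y = d k by apply: eq_bigr => j _; rewrite negbK.
case: k Hk kmin => [|k] Hk kmin.
  move: Hk; rewrite /c /d !take0.
  by rewrite !big1 // !muln0 !leqn0; move: m0 n0; case: m => //; case: n.
have : ~~ ((m <= 2 * c k) || (n <= 2 * d k))%N.
  by apply/negP => /kmin; rewrite ltnn.
have := cd_step k; have := c_mono k; have := d_mono k.
move: Hk; lia.
Qed.

End Median.

(** * Means over directions *)

Section Mean.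
Variables (R : realType) (n : nat).
Implicit Types (h : 'rV[R]_n -> R).

(** The class of functions for which the mean behaves as a linear and monotone
    operation with real values. *)
Definition bounded_measurable h :=
  measurable_fun [set: 'rV[R]_n] h /\ exists B, forall x, 0 <= h x <= B.

Definition mean h : R := fine (\int[@direction_law R n]_x (h x)%:E)%E.

Lemma meanE h : bounded_measurable h ->
  (mean h)%:E = (\int[@direction_law R n]_x (h x)%:E)%E.
Proof.
move=> [mh [B hB]]; rewrite fineK// ge0_fin_numE; last first.
  by apply: integral_ge0 => x _; rewrite lee_fin; have /andP[] := hB x.
apply: (@le_lt_trans _ _ (\int[@direction_law R n]_x B%:E)%E).
  apply: ge0_le_integral => //.
  - by move=> x _; rewrite lee_fin; have /andP[] := hB x.
  - exact/measurable_EFinP.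
  - by move=> x _; rewrite lee_fin; have /andP[] := hB x.
by rewrite integral_cst//= probability_setT mule1 ltry.
Qed.

Lemma mean_le h h' : bounded_measurable h -> bounded_measurable h' ->
  (forall x, h x <= h' x) -> mean h <= mean h'.
Proof.
move=> bh bh' hh'; rewrite -lee_fin !meanE//.
case: bh bh' => [mh [B hB]] [mh' [B' hB']]; apply: ge0_le_integral => //.
- by move=> x _; rewrite lee_fin; have /andP[] := hB x.
- exact/measurable_EFinP.
- exact/measurable_EFinP.
- by move=> x _; rewrite lee_fin.
Qed.

Lemma bounded_measurable_cst c : 0 <= c -> bounded_measurable (fun=> c).
Proof. by move=> c0; split => //; exists c => x; rewrite c0 lexx. Qed.

Lemma mean_cst c : 0 <= c -> mean (fun=> c) = c.
Proof.
move=> c0; apply: EFin_inj; rewrite meanE; last exact: bounded_measurable_cst.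
by rewrite integral_cst//= probability_setT mule1.
Qed.

Lemma bounded_measurableD h h' : bounded_measurable h -> bounded_measurable h' ->
  bounded_measurable (fun x => h x + h' x).
Proof.
move=> [mh [B hB]] [mh' [B' hB']]; split; first exact: measurable_funD.
exists (B + B') => x; have /andP[? ?] := hB x; have /andP[? ?] := hB' x.
by rewrite addr_ge0// lerD.
Qed.

Lemma meanD h h' : bounded_measurable h -> bounded_measurable h' ->
  mean (fun x => h x + h' x) = mean h + mean h'.
Proof.
move=> bh bh'; apply: EFin_inj.
rewrite EFinD !meanE//; last exact: bounded_measurableD.
case: bh bh' => [mh [B hB]] [mh' [B' hB']].
under eq_integral do rewrite EFinD.
apply: ge0_integralD => //.
- by move=> x _; rewrite lee_fin; have /andP[] := hB x.
- exact/measurable_EFinP.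
- by move=> x _; rewrite lee_fin; have /andP[] := hB' x.
- exact/measurable_EFinP.
Qed.

Lemma bounded_measurableZ c h : 0 <= c -> bounded_measurable h ->
  bounded_measurable (fun x => c * h x).
Proof.
move=> c0 [mh [B hB]]; split; first exact: measurable_funM.
exists (c * B) => x; have /andP[? ?] := hB x.
by rewrite mulr_ge0// ler_wpM2l.
Qed.

Lemma meanZ c h : 0 <= c -> bounded_measurable h ->
  mean (fun x => c * h x) = c * mean h.
Proof.
move=> c0 bh; apply: EFin_inj.
rewrite EFinM !meanE//; last exact: bounded_measurableZ.
case: bh => [mh [B hB]]; under eq_integral do rewrite EFinM.
apply: ge0_integralZl => //; first exact/measurable_EFinP.
by move=> x _; rewrite lee_fin; have /andP[] := hB x.
Qed.

Lemma bounded_measurable_sum (I : Type) (r : seq I) (F : I -> 'rV[R]_n -> R) :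
  (forall i, bounded_measurable (F i)) ->
  bounded_measurable (fun x => \sum_(i <- r) F i x).
Proof.
move=> bF; elim: r => [|i r IH].
  by under eq_fun do rewrite big_nil; exact: bounded_measurable_cst.
by under eq_fun do rewrite big_cons; exact: bounded_measurableD.
Qed.

Lemma mean_sum (I : Type) (r : seq I) (F : I -> 'rV[R]_n -> R) :
  (forall i, bounded_measurable (F i)) ->
  mean (fun x => \sum_(i <- r) F i x) = \sum_(i <- r) mean (F i).
Proof.
move=> bF; elim: r => [|i r IH].
  by under eq_fun do rewrite big_nil; rewrite big_nil mean_cst.
under eq_fun do rewrite big_cons.
by rewrite big_cons meanD ?IH//; exact: bounded_measurable_sum.
Qed.

Lemma bounded_measurable_indic A : measurable A ->
  bounded_measurable (\1_A : 'rV[R]_n -> R).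
Proof.
move=> mA; split; first exact: measurable_indic.
by exists 1 => x; rewrite indicE ler0n lern1 leq_b1.
Qed.

Lemma mean_indic A : measurable A -> mean (\1_A) = prob A.
Proof.
by move=> mA; rewrite /mean integral_indic// setIT.
Qed.

End Mean.

(** * The contribution of a vertex *)

Section VertexCharacter.
Variables (R : realType) (G : graph) (N : nat) (f : C2_map R G N).

Definition local_excess q x := Num.max (chi_sum f q x) 0.

Lemma chi_le1 (T x : 'rV[R]_N) : chi T x <= 1.
Proof.
rewrite /chi; have [d0|d0|->] := ltgtP (dotp x T) 0.
- by rewrite ltr0_sg//; lra.
- by rewrite gtr0_sg//; lra.
- by rewrite sgr0; lra.
Qed.

Lemma chi_normalize (T x : 'rV[R]_N) : chi T (normalize x) = chi T x.
Proof.
rewrite /chi /normalize dotpZl sgrM; have [->|x0] := eqVneq x 0.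
  by rewrite dotp0l sgr0 mulr0.
by rewrite gtr0_sg ?mul1r// invr_gt0 enorm_gt0.
Qed.

Lemma measurable_chi (T : 'rV[R]_N) : measurable_fun [set: 'rV[R]_N] (chi T).
Proof.
apply: measurableT_comp => //.
apply: measurable_fun_ifT => //.
  by apply: measurable_fun_eqr => //; exact: measurable_dotp.
apply: measurable_fun_ifT => //.
by apply: measurable_fun_ltr => //; exact: measurable_dotp.
Qed.

Lemma bounded_measurable_excess q : bounded_measurable (local_excess q).
Proof.
split.
  apply: measurable_maxr => //; apply: measurable_funD.
    rewrite (_ : (fun x => _) = (fun x => \sum_(a : edge G)
      if src a == q then chi (unit_tangent (arc f a) 0) x else 0)); last first.
      by apply/funext => x; rewrite big_mkcond.
    by apply: measurable_sum => a; case: (src a == q) => //; exact: measurable_chi.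
  rewrite (_ : (fun x => _) = (fun x => \sum_(a : edge G)
    if tgt a == q then chi (- unit_tangent (arc f a) 1) x else 0)); last first.
    by apply/funext => x; rewrite big_mkcond.
  by apply: measurable_sum => a; case: (tgt a == q) => //; exact: measurable_chi.
exists (\sum_(a : edge G | src a == q) 1 + \sum_(a : edge G | tgt a == q) 1).
move=> x; rewrite le_max lexx orbT ge_max/=; apply/andP; split; last first.
  by rewrite addr_ge0// sumr_ge0.
by apply: lerD; apply: ler_sum => a _; exact: chi_le1.
Qed.

Lemma ntcE q : ntc f q = pi * mean (local_excess q).
Proof.
rewrite /ntc sphere_meanE//.
- by case: (bounded_measurable_excess q).
- by move=> x; rewrite le_max lexx orbT.
- by move=> x; rewrite /chi_sum; congr Num.max; congr (_ + _);
    apply: eq_bigr => a _; rewrite chi_normalize.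
Qed.

End VertexCharacter.

(** * Height functions of arcs *)

Section StrictlyMonotone.
Variables (R : realType) (phi dphi : R -> R).
Hypothesis dphiP : forall t : R, is_derive t 1 phi (dphi t).

Let MVT' (a b : R) : a <= b ->
  exists2 c, a <= c <= b & phi b - phi a = dphi c * (b - a).
Proof.
move=> ab.
have cphi : {within `[a, b], continuous phi}.
  by apply: derivable_within_continuous => x _; have [] := dphiP x.
have [c cab E] := MVT_segment ab (fun x _ => dphiP x) cphi.
by exists c => //; move: cab; rewrite in_itv.
Qed.

(** The derivative is positive on an interval [a, b] around c, and the mean value
    theorem is applied on [0, a], [a, b] and [b, 1]. *)
Lemma lt_of_derive_ge0 c : {for c, continuous dphi} ->
  (forall t, 0 <= t <= 1 -> 0 <= dphi t) -> 0 <= c <= 1 -> 0 < dphi c ->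
  phi 0 < phi 1.
Proof.
move=> cont d0 /andP[c0 c1] dc.
have [e /= e0 He] : \forall t \near c, 0 < dphi t.
  move/cvgrPdist_lt : cont => /(_ _ dc); apply: filterS => t.
  by rewrite ltr_norml => /andP[_ ?]; lra.
pose a := Num.max 0 (c - e / 2); pose b := Num.min 1 (c + e / 2).
have a0 : 0 <= a by rewrite le_max lexx.
have b1 : b <= 1 by rewrite ge_min lexx.
have ac : a <= c by rewrite ge_max c0/=; lra.
have cb : c <= b by rewrite le_min c1/=; lra.
have ab : a < b by rewrite gt_max !lt_min; apply/andP; split; apply/andP; split; lra.
have [x1 x1P E1] := MVT' a0.
have [x2 x2P E2] := MVT' (ltW ab).
have [x3 x3P E3] := MVT' b1.
have x2c : 0 < dphi x2.
  apply: He; rewrite /ball_/= ltr_norml.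
  have := x2P; rewrite ge_max le_min -!andbA => /and4P[? ? ? ?].
  by apply/andP; split; lra.
have H1 : 0 <= dphi x1 * (a - 0).
  by rewrite mulr_ge0 ?subr_ge0// d0//; move: x1P; lra.
have H2 : 0 < dphi x2 * (b - a) by rewrite mulr_gt0// subr_gt0.
have H3 : 0 <= dphi x3 * (1 - b).
  by rewrite mulr_ge0 ?subr_ge0// d0//; move: x3P; lra.
by rewrite -E1 in H1; rewrite -E2 in H2; rewrite -E3 in H3; lra.
Qed.

End StrictlyMonotone.

Section Heights.
Variables (R : realType) (n : nat) (g : R -> 'rV[R]_n).
Hypothesis C2g : regular_C2 g.
Notation T := (unit_tangent g).

Let dP (y : 'rV[R]_n) (t : R) :
  is_derive t 1 (fun s => dotp y (g s)) (dotp y (derive1 g t)).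
Proof.
have [dg _ _ _] := C2g.
have dy : derivable (fun _ : R => y) t 1 by exact: derivable_cst.
apply: is_derive_eq; first exact: (is_derive_dotp dy (dg t)).
by rewrite derive1_cst (dotpC _ 0) dotp0l addr0.
Qed.

Let contd (y : 'rV[R]_n) : continuous (fun t => dotp y (derive1 g t)).
Proof.
have [_ dg1 _ _] := C2g; move=> t.
have dy : derivable (fun _ : R => y) t 1 by exact: derivable_cst.
apply: differentiable_continuous; apply/derivable1_diffP.
by have [] := is_derive_dotp dy (dg1 t).
Qed.

Let T_g1 (y : 'rV[R]_n) t : 0 <= t <= 1 ->
  exists2 s, 0 < s & dotp y (T t) = s * dotp y (derive1 g t).
Proof.
have [_ _ _ g1] := C2g => t01; exists (enorm (derive1 g t))^-1.
  by rewrite invr_gt0 enorm_gt0 g1.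
by rewrite /unit_tangent /normalize dotpZr.
Qed.

(** An arc that does not end above its start, and goes up at some time, must go
    down at some other time.  The heights of the ends may be equal: the slope at c
    excludes that the height is constant. *)
Lemma exists_descent (y : 'rV[R]_n) c : 0 <= c <= 1 -> 0 < dotp y (T c) ->
  dotp y (g 1) <= dotp y (g 0) -> exists2 t, 0 <= t <= 1 & dotp y (T t) < 0.
Proof.
move=> c01 yc g10; apply: contrapT => no.
suff : dotp y (g 0) < dotp y (g 1) by rewrite ltNge g10.
apply: (lt_of_derive_ge0 (dP y) (@contd y c)) => //.
  move=> t t01; have [s s0 E] := T_g1 y t01.
  rewrite leNgt; apply/negP => H; apply: no; exists t => //.
  by rewrite E pmulr_rlt0.
have [s s0 E] := T_g1 y c01.
by move: yc; rewrite E pmulr_rgt0.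
Qed.

End Heights.

(** * The lower bound *)

(** The indicators z0 and z1 of null sets, multiplied by C, make a pointwise lower
    bound by C valid for the exceptional directions too. *)
Lemma penalty_ge (R : realDomainType) (C s z0 z1 : R) :
  0 <= C -> 0 <= s -> 0 <= z0 -> 0 <= z1 -> z0 = 1 \/ z1 = 1 ->
  C <= 2 * s + (C * z0 + C * z1).
Proof.
move=> C0 s0 z00 z10 [->|->]; rewrite mulr1.
  by have := mulr_ge0 C0 z10; lra.
by have := mulr_ge0 C0 z00; lra.
Qed.

Lemma mean_penalty (R : realType) (n : nat) (C : R) (S Z0 Z1 : set 'rV[R]_n) :
  0 <= C -> measurable S -> measurable Z0 -> measurable Z1 ->
  prob Z0 = 0 -> prob Z1 = 0 ->
  mean (fun x => 2 * \1_S x + (C * \1_Z0 x + C * \1_Z1 x)) = 2 * prob S.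
Proof.
move=> C0 mS mZ0 mZ1 z0 z1.
have b c A : 0 <= c -> measurable A -> bounded_measurable (fun x : 'rV[R]_n => c * \1_A x).
  by move=> c0 mA; exact/bounded_measurableZ/bounded_measurable_indic.
have mean_scaled c A : 0 <= c -> measurable A ->
    mean (fun x : 'rV[R]_n => c * \1_A x) = c * prob A.
  by move=> c0 mA; rewrite (meanZ c0 (bounded_measurable_indic mA)) mean_indic.
have bS := b 2 S (ler0n _ _) mS; have bZ0 := b C Z0 C0 mZ0; have bZ1 := b C Z1 C0 mZ1.
rewrite (meanD bS (bounded_measurableD bZ0 bZ1)) (meanD bZ0 bZ1).
by rewrite !mean_scaled// z0 z1 mulr0 !addr0.
Qed.

Section LowerBound.
Variables (R : realType) (G : graph) (N : nat) (f : C2_map R G N).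

(** Averaging over directions: the vertex terms are means of the excesses, and the
    total curvature of an arc is at least 2 pi times the probability of S a, by
    crofton.  For a direction x orthogonal to none of the tangents at the ends of
    the arcs, crossing_le_max, applied to the cut given for the heights
    dotp x (vpos f), bounds the sum of these contributions below by C. *)
Lemma NTC_ge (C : R) : 0 <= C ->
  (forall h : vertex G -> R, exists S : pred (vertex G),
    upper h S /\ C <= \sum_(a : edge G) (crossing S a)%:R) ->
  ((C * pi)%:E <= NTC f)%E.
Proof.
move=> C0 cut.
pose T a t := unit_tangent (arc f a) t.
have [S HS] : exists S : edge G -> set 'rV[R]_N, forall a,
  [/\ measurable (S a),
   forall x s t, 0 <= s -> s <= t -> t <= 1 ->
     0 < dotp x (T a s) -> dotp x (T a t) < 0 -> S a x &
   ((2 * pi * prob (S a))%:E <= total_curvature (arc f a))%E].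
  have /choice[S HS] := fun a => crofton (arc_regular f a).
  by exists S.
pose Z t a := [set x : 'rV[R]_N | dotp x (T a t) = 0].
have mZ t a : measurable (Z t a) by exact: measurable_hyperplane.
have Z0 t a : 0 <= t <= 1 -> prob (Z t a) = 0.
  move=> t01; rewrite /prob direction_law_hyperplane//.
  rewrite -enorm_eq0 enorm_normalize ?oner_eq0//.
  by have [_ _ _ g1] := arc_regular f a; exact: g1.
have mS a : measurable (S a) by have [] := HS a.
pose extra a x : R := 2 * \1_(S a) x + (C * \1_(Z 0 a) x + C * \1_(Z 1 a) x).
have bindic := @bounded_measurable_indic R N.
have bCZ t a : bounded_measurable (fun x => C * \1_(Z t a) x).
  by apply: bounded_measurableZ => //; exact: bindic.
have b2S a : bounded_measurable (fun x => 2 * \1_(S a) x).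
  by apply: bounded_measurableZ => //; exact: bindic.
have bextra a : bounded_measurable (extra a).
  by apply: bounded_measurableD => //; exact: bounded_measurableD.
have pointwise x : C <= \sum_(q : vertex G) local_excess f q x + \sum_(a : edge G) extra a x.
  have ex0 q : 0 <= local_excess f q x by rewrite le_max lexx orbT.
  have in0 A : 0 <= \1_A x :> R by rewrite indicE.
  have extra0 a : 0 <= extra a x by rewrite !addr_ge0 ?mulr_ge0.
  (* Exceptional directions are paid for by the penalty terms of extra. *)
  have [[a [t [t01 Zt]]]|generic] :=
      pselect (exists a t, (t = 0 \/ t = 1) /\ Z t a x).
    apply: (@le_trans _ _ (extra a x)).
      apply: penalty_ge => //.
      by case: t01 Zt => -> Zt; [left|right]; rewrite indicE mem_set.
    rewrite (bigD1 a)//= addrCA lerDl addr_ge0//; apply: sumr_ge0 => *; auto.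
  have gen a t : t = 0 \/ t = 1 -> dotp x (T a t) != 0.
    by move=> t01; apply/eqP => E; apply: generic; exists a, t.
  have [U [up CU]] := cut (fun q => dotp x (vpos f q)).
  apply: le_trans CU _.
  pose s t a := Num.sg (dotp x (T a t)).
  have sE t a : t = 0 \/ t = 1 -> s t a = 1 \/ s t a = -1.
    move=> t01; have := gen a t t01; rewrite /s neq_lt => /orP[d0|d0].
      by right; rewrite ltr0_sg.
    by left; rewrite gtr0_sg.
  have sP t a : s t a = 1 -> 0 < dotp x (T a t).
    by move=> E; rewrite -sgr_gt0 -/(s t a) E.
  have sN t a : s t a = -1 -> dotp x (T a t) < 0.
    by move=> E; rewrite -sgr_lt0 -/(s t a) E ltrN10.
  have H := crossing_le_max (s0 := s 0) (s1 := s 1) (p := fun a => x \in S a) up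
    (fun a => sE 0 a (or_introl erefl)) (fun a => sE 1 a (or_intror erefl)).
  apply: le_trans (H _ _ _) _.
  - move=> a /sP s0 /sN s1; have [_ HSa _] := HS a.
    by rewrite inE; exact: (HSa x 0 1).
  - move=> a hle /sN s1; have [_ HSa _] := HS a.
    have : exists2 t, 0 <= t <= 1 & dotp (- x) (T a t) < 0.
      apply: (exists_descent (arc_regular f a) (c := 1)); first by rewrite ler01 lexx.
        by rewrite dotpNl oppr_gt0.
      by rewrite !dotpNl lerN2 arc_src arc_tgt.
    move=> [t /andP[t0 t1]]; rewrite dotpNl oppr_lt0 => xt.
    by rewrite inE; exact: (HSa x t 1).
  - move=> a hle /sP s0; have [_ HSa _] := HS a.
    have [t /andP[t0 t1] xt] : exists2 t, 0 <= t <= 1 & dotp x (T a t) < 0.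
      apply: (exists_descent (arc_regular f a) (c := 0)) => //.
        by rewrite lexx ler01.
      by rewrite arc_src arc_tgt.
    by rewrite inE; exact: (HSa x 0 t).
  apply: lerD.
    apply: ler_sum => q _; rewrite /local_excess /chi_sum.
    rewrite [X in _ <= Num.max (_ + X) _](eq_bigr (fun a => s 1 a)) ?lexx// => a _.
    by rewrite /chi dotpNr sgrN opprK.
  apply: ler_sum => a _; rewrite /extra indicE lerDl.
  by rewrite addr_ge0 ?mulr_ge0.
have C_le : C <= \sum_q mean (local_excess f q) + \sum_a 2 * prob (S a).
  rewrite -[leLHS](@mean_cst R N)//.
  have bq := bounded_measurable_excess f.
  apply: le_trans (mean_le _ _ pointwise) _.
  - exact: bounded_measurable_cst.
  - by apply: bounded_measurableD; apply: bounded_measurable_sum.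
  rewrite meanD; [|exact: bounded_measurable_sum..].
  rewrite !mean_sum// lerD2l; apply: ler_sum => a _.
  have z0 : prob (Z 0 a) = 0 by apply: Z0; rewrite lexx ler01.
  have z1 : prob (Z 1 a) = 0 by apply: Z0; rewrite lexx ler01.
  by rewrite (mean_penalty C0 (mS a) (mZ 0 a) (mZ 1 a) z0 z1).
have pi0 : 0 <= pi :> R by exact: pi_ge0.
apply: (@le_trans _ _ ((pi * \sum_q mean (local_excess f q))%:E +
   \sum_a (2 * pi * prob (S a))%:E)%E).
  rewrite sumEFin -EFinD lee_fin mulrC.
  apply: le_trans (ler_wpM2l pi0 C_le) _.
  rewrite mulrDr lerD2l mulr_sumr; apply: ler_sum => a _.
  by rewrite mulrA [pi * 2]mulrC.
rewrite /NTC; apply: leeD; last by apply: lee_sum => a _; have [] := HS a.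
rewrite lee_fin mulr_sumr; apply: ler_sum => q _.
by rewrite ntcE.
Qed.

End LowerBound.

Section Bipartite.
Variable R : realType.

(** With x of the m vertices and y of the n vertices below the cut,
    2 (x (n - y) + (m - x) y) - m n = (m - 2 x) (2 y - n) >= 0. *)
Lemma bipartite_crossing (m n : nat) (a : 'I_m -> bool) (b : 'I_n -> bool) :
  let x := (\sum_(i < m) ~~ a i)%N in
  let y := (\sum_(j < n) ~~ b j)%N in
  ((m <= 2 * x) && (2 * y <= n) || (n <= 2 * y) && (2 * x <= m))%N ->
  (m * n <= 2 * \sum_(e : 'I_m * 'I_n) (a e.1 != b e.2))%N.
Proof.
move=> x y xy.
have xE : (\sum_(i < m) a i + x = m)%N.
  rewrite -big_split/= (eq_bigr (fun=> 1%N)) ?sum1_card ?card_ord// => i _.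
  by case: (a i).
have yE : (\sum_(j < n) b j + y = n)%N.
  rewrite -big_split/= (eq_bigr (fun=> 1%N)) ?sum1_card ?card_ord// => j _.
  by case: (b j).
have -> : (\sum_(e : 'I_m * 'I_n) (a e.1 != b e.2) =
    x * \sum_(j < n) b j + (\sum_(i < m) a i) * y)%N.
  rewrite -(pair_bigA _ (fun i j => (a i != b j) : nat))/=.
  rewrite !big_distrl -big_split/=; apply: eq_bigr => i _.
  by case: (a i); rewrite ?mul0n ?mul1n ?addn0 ?add0n; apply: eq_bigr => j _;
    case: (b j).
move: (\sum_(i < m) a i)%N (\sum_(j < n) b j)%N x y xE yE xy => x' y' x y <- <-.
move=> /orP[] /andP[]; nia.
Qed.

Lemma NTC_Kmn_ge (m n N : nat) (k : edge (Kmn m n) -> nat)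
    (f : C2_map R (subdivision k) N) : (0 < m)%N -> (0 < n)%N ->
  (((Num.ceil ((m * n)%:R / 2 : R))%:~R * pi)%:E <= NTC f)%E.
Proof.
move=> m0 n0; apply: NTC_ge => [|h].
  by rewrite ler0z ceil_ge0 (lt_le_trans (ltrN10 _))// divr_ge0.
have [S [up cut]] := median_cut (f := inl : _ -> vertex (subdivision k)) h inl_inj m0 n0.
exists S; split => //.
have H := bipartite_crossing cut.
have H' := @crossing_lift (Kmn m n) k S.
rewrite -natr_sum -[leRHS]mulrz_nat ler_int ceil_le_int.
rewrite ler_pdivrMr// mulrz_nat -natrM ler_nat mulnC.
rewrite mulnC; apply: (leq_trans H); by rewrite mulnC leq_mul2r H'.
Qed.

End Bipartite.

(** * Straight maps to the line *)

Section Straight.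
Variables (R : realType) (G : graph) (pos : vertex G -> R).
Hypothesis pos_edge : forall e, pos (src e) != pos (tgt e).

(* The graph itself, as its subdivision without new vertices. *)
Let k0 (e : edge G) := 0%N.
Let H := subdivision k0.

Let posH (q : vertex H) : R := if q is inl v then pos v else 0.

Let srcH (a : edge H) : src a = inl (src (tag a)).
Proof. by case: a => e i; rewrite /= (ord1 i); case: unliftP => // j; case: j. Qed.

Let tgtH (a : edge H) : tgt a = inl (tgt (tag a)).
Proof. by case: a => e i; rewrite /= (ord1 i); case: unliftP => // j; case: j. Qed.

Let place (y : R) : 'rV[R]_1 := \row__ y.

Let vec (a : edge H) : 'rV[R]_1 := place (posH (tgt a)) - place (posH (src a)).

Let vec_neq0 a : vec a != 0.
Proof.
rewrite subr_eq0; apply/eqP => /rowP/(_ 0); rewrite !mxE srcH tgtH/= => E.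
by have /eqP := pos_edge (tag a); rewrite E.
Qed.

Let seg (a : edge H) (t : R) : 'rV[R]_1 := t *: vec a + place (posH (src a)).

Let is_derive_seg a (t : R) : is_derive t 1 (seg a) (vec a).
Proof.
have D i : is_derive t 1 (fun s => seg a s 0 i) (vec a 0 i).
  have := is_deriveD (is_deriveM (is_derive_id t 1) (is_derive_cst (vec a 0 i) t 1))
    (is_derive_cst (place (posH (src a)) 0 i) t 1).
  rewrite (_ : _ + _ = fun s => seg a s 0 i); last first.
    by apply/funext => s; rewrite /seg !mxE.
  by move/is_derive_eq; apply; rewrite scaler0 add0r addr0 /GRing.scale/= mulr1.
have dseg : derivable (seg a) t 1.
  by apply/derivable_mxP => i j; rewrite (ord1 i); have [] := D j.
apply: DeriveDef => //; rewrite derive_mx//.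
by apply/matrixP => i j; rewrite mxE (ord1 i); have [_] := D j.
Qed.

Let derive1_seg a : derive1 (seg a) = cst (vec a).
Proof. by apply/funext => t; rewrite derive1E; have [_ ->] := is_derive_seg a t. Qed.

Lemma seg_regular a : regular_C2 (seg a).
Proof.
split.
- by move=> t; have [] := is_derive_seg a t.
- by rewrite derive1_seg => t; exact: derivable_cst.
- rewrite derive1_seg; rewrite (_ : derive1 _ = cst 0); first exact: cst_continuous.
  by apply/funext => t; rewrite derive1_cst.
- by move=> t _; rewrite derive1_seg vec_neq0.
Qed.

Lemma seg_src a : seg a 0 = place (posH (src a)).
Proof. by rewrite /seg scale0r add0r. Qed.

Lemma seg_tgt a : seg a 1 = place (posH (tgt a)).
Proof. by rewrite /seg scale1r subrK. Qed.

Definition straight : C2_map R H 1 :=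
  @C2Map R H 1 (fun q => place (posH q)) seg seg_regular seg_src seg_tgt.

Lemma total_curvature_straight a : total_curvature (arc straight a) = 0%E.
Proof.
rewrite /total_curvature /=.
rewrite (eq_integral (cst 0%E)) ?integral0// => t _.
rewrite /curvature.
have -> : unit_tangent (seg a) = cst (normalize (vec a)).
  by apply/funext => s; rewrite /unit_tangent derive1_seg.
rewrite derive1_cst scaler0 (_ : enorm 0 = 0) ?mul0r//.
by apply/eqP; rewrite enorm_eq0.
Qed.

(** The number of edge-ends at v that go down minus the number of those that go
    up, when the heights are pos. *)
Definition balance (v : vertex G) : R :=
  \sum_(e : edge G | src e == v) - Num.sg (pos (tgt e) - pos (src e)) +
  \sum_(e : edge G | tgt e == v) Num.sg (pos (tgt e) - pos (src e)).

Let whole (e : edge G) : edge H := existT (fun e => 'I_(k0 e).+1) e ord0.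

Let sum_edge (P : pred (edge H)) (F : edge H -> R) :
  \sum_(a | P a) F a = \sum_(e | P (whole e)) F (whole e).
Proof.
rewrite (reindex whole)//; apply: onW_bij.
by exists (@tag _ _) => [e //|[e i]]; rewrite (ord1 i).
Qed.

Let sg_dotp a (x : 'rV[R]_1) : Num.sg (dotp x (normalize (vec a))) =
  Num.sg (x 0 0) * Num.sg (pos (tgt (tag a)) - pos (src (tag a))).
Proof.
rewrite /normalize dotpZr sgrM gtr0_sg ?invr_gt0 ?enorm_gt0// mul1r.
by rewrite /dotp big_ord1 sgrM !mxE srcH tgtH.
Qed.

Lemma excess_straight (v : vertex G) x :
  local_excess straight (inl v) x = Num.max (Num.sg (x 0 0) * balance v) 0.
Proof.
rewrite /local_excess /chi_sum; congr Num.max.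
rewrite !sum_edge mulrDr !mulr_sumr; congr (_ + _).
  apply: eq_big => [e|e _]; first by rewrite srcH.
  by rewrite /chi /unit_tangent /= derive1_seg sg_dotp mulrN.
apply: eq_big => [e|e _]; first by rewrite tgtH.
by rewrite /chi /unit_tangent /= derive1_seg dotpNr sgrN opprK sg_dotp.
Qed.

(** Segments have no curvature, and there are only two directions on the line. *)
Lemma NTC_straight_le (C : R) : 0 <= C ->
  \sum_v Num.max (balance v) 0 <= C ->
  \sum_v Num.max (- balance v) 0 <= C ->
  (NTC straight <= (C * pi)%:E)%E.
Proof.
move=> C0 Cp Cn.
rewrite /NTC [X in (_ + X)%E]big1 ?adde0; last by move=> a _; exact: total_curvature_straight.
rewrite lee_fin mulrC.
under eq_bigr do rewrite ntcE.
rewrite -mulr_sumr ler_wpM2l ?pi_ge0//.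
have bq := bounded_measurable_excess straight.
rewrite -mean_sum//.
rewrite -[leRHS](@mean_cst R 1)//.
apply: mean_le; [exact: bounded_measurable_sum|exact: bounded_measurable_cst|].
move=> x; rewrite big_sumType/= [X in _ + X]big1 ?addr0; last first.
  by move=> [e [i ?]].
under eq_bigr do rewrite excess_straight.
have [x0|x0|->] := ltgtP (x 0 0) 0.
- by rewrite ltr0_sg//; under eq_bigr do rewrite mulN1r.
- by rewrite gtr0_sg//; under eq_bigr do rewrite mul1r.
- by rewrite sgr0 big1// => v _; rewrite mul0r maxxx.
Qed.

End Straight.

(** * An optimal placement of the complete bipartite graph *)

Section Placement.
Variables (R : realType) (m n : nat).

Let vp (i : nat) : R :=
  if (i < m./2)%N then - 2 else if (i < m./2 + m./2)%N then 2 else 0.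
Let wp (j : nat) : R := if (j < n./2)%N then 1 else - 1.

(** The v_i are put in halves at - 2 and 2, with the remaining one at 0 if m is
    odd, and the w_j in halves at 1 and - 1, with the remaining one at - 1 if n is
    odd.  Then only the vertices at 2 have a large positive balance, namely n; the
    balance is odd n at 0, odd m at 1, - odd m at - 1 and - n at - 2. *)
Definition Kmn_pos (v : vertex (Kmn m n)) : R :=
  match v with inl i => vp i | inr j => wp j end.

Lemma Kmn_pos_edge e : Kmn_pos (@src (Kmn m n) e) != Kmn_pos (tgt e).
Proof.
rewrite /= /vp /wp; case: ifP => _; [|case: ifP => _]; case: ifP => _;
  by apply/eqP; lra.
Qed.

Let sum_vp (phi : R -> R) : \sum_(i < m) phi (vp i) =
  (m./2)%:R * phi (- 2) + (m./2)%:R * phi 2 + (odd m)%:R * phi 0.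
Proof.
rewrite -(big_mkord xpredT (fun i => phi (vp i))).
have mE : m = (m./2 + m./2 + odd m)%N by rewrite addnn addnC odd_double_half.
rewrite (@big_cat_nat _ _ _ (m./2))//=; last by rewrite {2}mE -addnA leq_addr.
rewrite (@big_cat_nat _ _ _ (m./2 + m./2) (m./2) m)//=; last 2 first.
- exact: leq_addr.
- by rewrite {3}mE leq_addr.
rewrite -addrA; congr (_ + (_ + _)).
- rewrite (eq_big_nat _ _ (F2 := fun=> phi (-2))).
    by rewrite sumr_const_nat subn0 mulr_natl.
  by move=> i /andP[_ im]; rewrite /vp im.
- rewrite (eq_big_nat _ _ (F2 := fun=> phi 2)).
    by rewrite sumr_const_nat addnK mulr_natl.
  by move=> i /andP[i1 i2]; rewrite /vp ltnNge i1 i2.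
- rewrite (eq_big_nat _ _ (F2 := fun=> phi 0)).
    by rewrite sumr_const_nat {1}mE addKn mulr_natl.
  move=> i /andP[i1 i2]; rewrite /vp !ltnNge i1/= (leq_trans _ i1)//.
  exact: leq_addr.
Qed.

Let sum_wp (phi : R -> R) : \sum_(j < n) phi (wp j) =
  (n./2)%:R * phi 1 + (n./2 + odd n)%:R * phi (- 1).
Proof.
rewrite -(big_mkord xpredT (fun j => phi (wp j))).
have nE : n = (n./2 + (n./2 + odd n))%N by rewrite addnA addnn addnC odd_double_half.
rewrite (@big_cat_nat _ _ _ (n./2))//=; last by rewrite {2}nE leq_addr.
congr (_ + _).
- rewrite (eq_big_nat _ _ (F2 := fun=> phi 1)).
    by rewrite sumr_const_nat subn0 mulr_natl.
  by move=> i /andP[_ im]; rewrite /wp im.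
- rewrite (eq_big_nat _ _ (F2 := fun=> phi (- 1))).
    by rewrite sumr_const_nat {1}nE addKn mulr_natl.
  by move=> i /andP[i1 _]; rewrite /wp ltnNge i1.
Qed.

Let bal_v (y : R) : R := - ((n./2)%:R * Num.sg (1 - y) +
  (n./2 + odd n)%:R * Num.sg (- 1 - y)).
Let bal_w (y : R) : R := (m./2)%:R * Num.sg (y + 2) +
  (m./2)%:R * Num.sg (y - 2) + (odd m)%:R * Num.sg y.

Let balance_v i : balance Kmn_pos (inl i) = bal_v (vp i).
Proof.
rewrite /balance [X in _ + X]big1 ?addr0; last by move=> e.
rewrite sumrN /bal_v -(sum_wp (fun y => Num.sg (y - vp i))); congr (- _).
rewrite big_mkcond/= -(pair_bigA _ (fun (i' : 'I_m) (j : 'I_n) => if inl i' == inl i :> 'I_m + 'I_n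
  then Num.sg (wp j - vp i') else 0))/=.
rewrite (bigD1 i)//= eqxx [X in _ + X]big1 ?addr0// => i' i'i.
by rewrite big1// => j _; rewrite (inj_eq inl_inj) (negPf i'i).
Qed.

Let balance_w j : balance Kmn_pos (inr j) = bal_w (wp j).
Proof.
rewrite /balance [X in X + _]big1 ?add0r; last by move=> e.
transitivity (\sum_(i < m) Num.sg (wp j - vp i)).
  rewrite big_mkcond/= -(pair_bigA _ (fun (i : 'I_m) (j' : 'I_n) => if inr j' == inr j :> 'I_m + 'I_n
    then Num.sg (wp j' - vp i) else 0))/=.
  apply: eq_bigr => i _; rewrite (bigD1 j)//= eqxx big1 ?addr0// => j' j'j.
  by rewrite (inj_eq inr_inj) (negPf j'j).
by rewrite (sum_vp (fun y => Num.sg (wp j - y))) /bal_w opprK subr0.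
Qed.

Let C : R := (Num.ceil ((m * n)%:R / 2 : R))%:~R.

Let le_C : (m./2 * n + odd m * (n./2 + odd n))%N%:R <= C.
Proof.
rewrite /C; set c := (_ + _)%N.
have c2 : (c * 2 <= (m * n).+1)%N.
  rewrite /c; have := odd_double_half m; have := odd_double_half n.
  by case: (odd m); case: (odd n); rewrite -!muln2; nia.
rewrite -[leLHS]mulrz_nat ler_int -[X in X <= _](subrK 1) lezD1 ceil_gt_int.
rewrite ltr_pdivlMr// rmorphB/= mulrz_nat mulrBl mul1r ltrBlDr.
by rewrite -natrM -natrD ltr_nat; lia.
Qed.

Let sum_balance (s : R) : \sum_v Num.max (s * balance Kmn_pos v) 0 =
  (m./2)%:R * Num.max (s * bal_v (- 2)) 0 + (m./2)%:R * Num.max (s * bal_v 2) 0 +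
  (odd m)%:R * Num.max (s * bal_v 0) 0 +
  ((n./2)%:R * Num.max (s * bal_w 1) 0 +
   (n./2 + odd n)%:R * Num.max (s * bal_w (- 1)) 0).
Proof.
rewrite big_sumType/= -(sum_vp (fun y => Num.max (s * bal_v y) 0)).
rewrite -(sum_wp (fun y => Num.max (s * bal_w y) 0)).
by congr (_ + _); apply: eq_bigr => i _; rewrite ?balance_v ?balance_w.
Qed.

Let sgp (y : R) : 0 < y -> Num.sg y = 1. Proof. exact: gtr0_sg. Qed.
Let sgn (y : R) : y < 0 -> Num.sg y = -1. Proof. exact: ltr0_sg. Qed.

Let nE : n%:R = (n./2)%:R + (n./2 + odd n)%:R :> R.
Proof. by rewrite -natrD addnA addnn addnC odd_double_half. Qed.

Let bal_vN2 : bal_v (- 2) = - n%:R.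
Proof. by rewrite /bal_v !sgp ?nE ?mulr1//; lra. Qed.

Let bal_v2 : bal_v 2 = n%:R.
Proof. by rewrite /bal_v !sgn ?nE; try lra. Qed.

Let bal_v0 : bal_v 0 = (odd n)%:R.
Proof. by rewrite /bal_v sgp ?sgn ?natrD; try lra. Qed.

Let bal_w1 : bal_w 1 = (odd m)%:R.
Proof. by rewrite /bal_w (sgp (y := 1 + 2)) ?(sgn (y := 1 - 2)) ?sgr1; try lra. Qed.

Let bal_wN1 : bal_w (- 1) = - (odd m)%:R.
Proof. by rewrite /bal_w (sgp (y := -1 + 2)) ?(sgn (y := -1 - 2)) ?(sgn (y := -1)); try lra. Qed.

Let maxr_nat (a : nat) : Num.max a%:R 0 = a%:R :> R.
Proof. by apply/max_idPl; rewrite ler0n. Qed.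
Let maxr_Nnat (a : nat) : Num.max (- a%:R) 0 = 0 :> R.
Proof. by apply/max_idPr; rewrite oppr_le0 ler0n. Qed.

(** The sum of the positive balances is m./2 n + odd m (n./2 + odd n), for the
    reversed heights as well, because all the balances add up to 0. *)
Lemma NTC_Kmn_le : exists f : C2_map R (@subdivision (Kmn m n) (fun=> 0%N)) 1,
  (NTC f <= (C * pi)%:E)%E.
Proof.
exists (straight Kmn_pos_edge); apply: NTC_straight_le.
- by apply: le_trans le_C; rewrite ler0n.
- under eq_bigr do rewrite -[balance _ _]mul1r.
  rewrite sum_balance !mul1r bal_vN2 bal_v2 bal_v0 bal_w1 bal_wN1.
  rewrite !maxr_nat !maxr_Nnat; apply: le_trans le_C.
  by rewrite !(natrD, natrM); lra.
- under eq_bigr do rewrite -[- _]mulN1r.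
  rewrite sum_balance !mulN1r bal_vN2 bal_v2 bal_v0 bal_w1 bal_wN1.
  rewrite !opprK !maxr_nat !maxr_Nnat; apply: le_trans le_C.
  by rewrite !(natrD, natrM); lra.
Qed.

End Placement.

Theorem proposition9 (R : realType) (m n : nat) (hm : (0 < m)%N) (hn : (0 < n)%N) :
  NTC_inf R (Kmn m n) = ((Num.ceil ((m * n)%:R / 2 : R))%:~R * pi)%:E.
Proof.
apply/eqP; rewrite eq_le; apply/andP; split.
  have [f fC] := NTC_Kmn_le R m n; apply: le_trans fC.
  by apply: ereal_inf_lbound; exists 1%N, (fun=> 0%N), f.
by apply: le_ereal_inf_tmp => _ [N [k [f [_ ->]]]]; exact: NTC_Kmn_ge.
Qed.
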